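(* There is a universal constant $C$ such that the following holds. Let $d\ge1$, $h>0$ and $\alpha>0$. Let $\rho^\ast\in\mathcal{P}_{\alpha,L}$, i.e. $\rho^\ast$ is an $\alpha$-subgaussian measure on $\mathbb{R}^d$ with an $L$-Lipschitz score $s^\ast$. Let $\rho_h^\ast=\rho^\ast*\mathcal{N}(0,hI_d)$. Let $\hat\rho$ be the empirical measure of an i.i.d. sample of size $n$ drawn from $\rho^\ast$ and $\hat\rho_h=\hat\rho*\mathcal{N}(0,hI_d)$. Assume that $h\le\frac1{4L}$ and $h\le\alpha^2$. Then $$\mathbb{E}\,H^2(\hat\rho_h,\rho_h^\ast)\le\frac1n\left(\frac{C\alpha^2\log n}{h}\right)^{d/2}+\frac{4d}{n}.$$
   Context: A probability distribution $\rho$ on $\mathbb{R}^d$ is $\alpha$-subgaussian ($0<\alpha<\infty$) if $\mathbb{E}_{\rho}\exp(\theta^\top(X-\mathbb{E}_\rho X))\le\exp(\alpha^2\|\theta\|^2/2)$ for all $\theta\in\mathbb{R}^d$. $\mathcal{P}_{\alpha,L}$ is the class of probability distributions on $\mathbb{R}^d$ with full support that have a density, are $\alpha$-subgaussian, and whose score function $s=\nabla\log\rho$ is $L$-Lipschitz (with $\alpha^2L\ge1$, so that the class is nonempty). The squared Hellinger distance between densities $p,q$ is $H^2(p,q)=\int_{\mathbb{R}^d}(\sqrt{p(x)}-\sqrt{q(x)})^2\,dx$. The expectation is over the i.i.d. sample. *)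

(* Defs.v *)
From HB Require Import structures.
From mathcomp Require Import all_boot all_order all_algebra.
From mathcomp Require Import all_classical all_reals all_analysis.

Set Implicit Arguments.
Unset Strict Implicit.
Unset Printing Implicit Defensive.

Import Order.TTheory GRing.Theory Num.Theory.
Import numFieldNormedType.Exports.

Local Open Scope classical_set_scope.
Local Open Scope ring_scope.

Section measurable_rV.
Context {disp : measure_display} {T : measurableType disp}.
Variable n : nat.

Let coord (i : 'I_n) (v : 'rV[T]_n) : T := v ord0 i.

Let rV_set0 : g_sigma_preimage coord set0.
Proof. exact: sigma_algebra0. Qed.

Let rV_setC A : g_sigma_preimage coord A -> g_sigma_preimage coord (~` A).
Proof. exact: sigma_algebraC. Qed.

Let rV_bigcup (F : _^nat) : (forall i, g_sigma_preimage coord (F i)) ->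
  g_sigma_preimage coord (\bigcup_i (F i)).
Proof. exact: sigma_algebra_bigcup. Qed.

(* The sigma-algebra generated by the coordinates, as for n.-tuple T; on *)
(* 'rV[R]_n with R : realType it is the Borel sigma-algebra. *)
HB.instance Definition _ := @isMeasurable.Build (measure_tuple_display disp)
  'rV[T]_n (g_sigma_preimage coord) rV_set0 rV_setC rV_bigcup.

Lemma measurable_coord (i : 'I_n) :
  measurable_fun [set: 'rV[T]_n] (fun v => v ord0 i).
Proof.
move=> _ Y mY; rewrite setTI; apply: sub_sigma_algebra => /=.
rewrite -bigcup_seq/=; exists i => /=; first by rewrite mem_index_enum.
by exists Y => //; rewrite setTI.
Qed.

Lemma measurable_fun_rV d0 (U : measurableType d0) (f : U -> 'rV[T]_n) :
  (forall i, measurable_fun [set: U] (fun u => f u ord0 i)) ->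
  measurable_fun [set: U] f.
Proof.
move=> mf; suff H : g_sigma_preimage (fun i u => f u ord0 i) `<=` measurable.
  move=> _ A mA; rewrite setTI; apply: H.
  rewrite (@g_sigma_preimage_comp _ _ _ _ coord _ f).
  by exists A => //; rewrite setTI.
apply: smallest_sub; first exact: sigma_algebra_measurable.
rewrite -bigcup_seq; apply: bigcup_sub => i _.
by move=> A [B mB <-]; exact: mf.
Qed.

End measurable_rV.

Section pushforward_sigma_additive.
Context d1 d2 (T1 : measurableType d1) (T2 : measurableType d2) (R : realType).
Variables (m : {measure set T1 -> \bar R}) (f : T1 -> T2).

Lemma pushforward_semi_sigma_additive : measurable_fun [set: T1] f ->
  semi_sigma_additive (pushforward m f).
Proof.
move=> mf F mF tF mUF; rewrite /pushforward preimage_bigcup.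
apply: measure_semi_sigma_additive.
- by move=> n; rewrite -[X in measurable X]setTI; exact: mf.
- apply/trivIsetP => /= i j _ _ ij; rewrite -preimage_setI.
  by move/trivIsetP : tF => /(_ _ _ _ _ ij) ->//; rewrite preimage_set0.
- by rewrite -preimage_bigcup -[X in measurable X]setTI; exact: mf.
Qed.

End pushforward_sigma_additive.

Section product_rV.
Context {R : realType}.

Definition cons_rV n (p : measurableTypeR R * 'rV[R]_n) : 'rV[R]_n.+1 :=
  \row_i (if unlift ord0 i is Some j then p.2 ord0 j else p.1).

Lemma measurable_cons_rV n : measurable_fun setT (@cons_rV n).
Proof.
apply: measurable_fun_rV => i.
case: (unliftP ord0 i) => [j ->|->].
  rewrite [X in measurable_fun _ X](_ : _ = (fun v : 'rV[R]_n => v ord0 j) \o snd).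
    by apply: measurableT_comp => //; exact: measurable_coord.
  by apply/funext => p /=; rewrite mxE liftK.
rewrite [X in measurable_fun _ X](_ : _ = fst).
  exact: measurable_fst.
by apply/funext => p /=; rewrite mxE unlift_none.
Qed.

Definition uncons_rV n (v : 'rV[R]_n.+1) : measurableTypeR R * 'rV[R]_n :=
  (v ord0 ord0, \row_j v ord0 (lift ord0 j)).

Lemma cons_rVK n : cancel (@cons_rV n) (@uncons_rV n).
Proof.
move=> [x v]; congr pair; first by rewrite mxE unlift_none.
by apply/rowP => j; rewrite !mxE liftK.
Qed.

Lemma measurable_uncons_rV n : measurable_fun setT (@uncons_rV n).
Proof.
apply/measurable_fun_pairP; split; first exact: (measurable_coord ord0).
apply: measurable_fun_rV => j /=.
under eq_fun do rewrite mxE.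
exact: measurable_coord.
Qed.

Section step.
Variables (mu : {sigma_finite_measure set (measurableTypeR R) -> \bar R}).
Variables (n : nat) (nu : {sigma_finite_measure set 'rV[R]_n -> \bar R}).

Definition cons_measure : set 'rV[R]_n.+1 -> \bar R :=
  pushforward (mu \x nu)%E (@cons_rV n).

Let cons_measure0 : cons_measure set0 = 0%E.
Proof. by rewrite /cons_measure /pushforward preimage_set0 measure0. Qed.

Let cons_measure_ge0 A : (0 <= cons_measure A)%E.
Proof. by rewrite /cons_measure /pushforward measure_ge0. Qed.

Let cons_measure_sigma_additive : semi_sigma_additive cons_measure.
Proof.
exact: pushforward_semi_sigma_additive (@measurable_cons_rV n).
Qed.

HB.instance Definition _ := isMeasure.Build _ _ _ cons_measure
  cons_measure0 cons_measure_ge0 cons_measure_sigma_additive.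

Let cons_measure_sigma_finite : sigma_finite setT cons_measure.
Proof.
have /sigma_finiteP[F [TF ndF Foo]] := sigma_finiteT mu.
have /sigma_finiteP[G [TG ndG Goo]] := sigma_finiteT nu.
exists (fun k => @uncons_rV n @^-1` (F k `*` G k)).
  rewrite -preimage_bigcup -[LHS](preimage_setT (@uncons_rV n)); congr preimage.
  apply/esym; rewrite -subTset => -[x y] _.
  have [k _ Fx] : (\bigcup_k F k) x by rewrite -TF.
  have [l _ Gy] : (\bigcup_k G k) y by rewrite -TG.
  exists (maxn k l) => //; split => /=.
  - by move: x Fx; exact/subsetPset/ndF/leq_maxl.
  - by move: y Gy; exact/subsetPset/ndG/leq_maxr.
move=> k; have [mF Fk] := Foo k; have [mG Gk] := Goo k.
split.
  rewrite -[X in measurable X]setTI; apply: measurable_uncons_rV => //.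
  exact: measurableX.
rewrite /cons_measure /pushforward -comp_preimage.
rewrite (_ : @uncons_rV n \o @cons_rV n = id) ?preimage_id; last first.
  by apply/funext => p; exact: cons_rVK.
by rewrite product_measure1E// lte_mul_pinfty// ge0_fin_numE.
Qed.

HB.instance Definition _ := Measure_isSigmaFinite.Build _ _ _ cons_measure
  cons_measure_sigma_finite.

End step.

Fixpoint product_rV (mu : {sigma_finite_measure set (measurableTypeR R) -> \bar R})
    n : {sigma_finite_measure set 'rV[R]_n -> \bar R} :=
  if n is m.+1 then cons_measure mu (product_rV mu m)
  else \d_(0 : 'rV[R]_0).

Lemma product_rV_setT (mu : {sigma_finite_measure set (measurableTypeR R) -> \bar R})
  n : mu setT = 1%E -> product_rV mu n setT = 1%E.
Proof.
move=> mu1; elim: n => [|n IHn] /=; first by rewrite diracT.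
rewrite /cons_measure /pushforward preimage_setT -setXTT.
by rewrite product_measure1E//= mu1 IHn mule1.
Qed.

Definition lebesgue_rV n : {sigma_finite_measure set 'rV[R]_n -> \bar R} :=
  product_rV lebesgue_measure n.

(* N(0, h I_n): independent N(0, h) coordinates; normal_prob takes the *)
(* standard deviation. *)
Definition gaussian_rV n (h : R) : set 'rV[R]_n -> \bar R :=
  product_rV (normal_prob 0 (Num.sqrt h)) n.
Arguments gaussian_rV n h A : clear implicits.

HB.instance Definition _ n h := Measure.on (gaussian_rV n h).

Let gaussian_rV_setT n h : gaussian_rV n h setT = 1%E.
Proof. by apply: product_rV_setT; exact: probability_setT. Qed.

HB.instance Definition _ n h :=
  Measure_isProbability.Build _ _ _ (gaussian_rV n h) (gaussian_rV_setT n h).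

End product_rV.
Arguments gaussian_rV {R} n h A.

Section convolution.
Context {R : realType} {d : nat}.

Let add_rV (p : 'rV[R]_d * 'rV[R]_d) : 'rV[R]_d := p.1 + p.2.

Let measurable_add_rV : measurable_fun setT add_rV.
Proof.
apply: measurable_fun_rV => i; under eq_fun do rewrite mxE.
apply: measurable_realfun.measurable_funD.
  by apply: (measurableT_comp (measurable_coord i)).
by apply: (measurableT_comp (measurable_coord i)).
Qed.

Variables mu nu : {finite_measure set 'rV[R]_d -> \bar R}.

Definition convolution : set 'rV[R]_d -> \bar R :=
  pushforward (mu \x nu)%E (fun p => p.1 + p.2).

Let convolution0 : convolution set0 = 0%E.
Proof. by rewrite /convolution /pushforward preimage_set0 measure0. Qed.

Let convolution_ge0 A : (0 <= convolution A)%E.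
Proof. by rewrite /convolution /pushforward measure_ge0. Qed.

Let convolution_sigma_additive : semi_sigma_additive convolution.
Proof. exact: pushforward_semi_sigma_additive measurable_add_rV. Qed.

HB.instance Definition _ := isMeasure.Build _ _ _ convolution
  convolution0 convolution_ge0 convolution_sigma_additive.

Let convolution_fin : fin_num_fun convolution.
Proof.
move=> A mA; rewrite ge0_fin_numE ?measure_ge0//.
apply: (@le_lt_trans _ _ (convolution setT)).
  by apply: le_measure; rewrite ?inE.
rewrite /convolution /pushforward preimage_setT -setXTT product_measure1E//.
by rewrite lte_mul_pinfty ?measure_ge0// ?fin_num_measure// ltey_eq fin_num_measure.
Qed.

HB.instance Definition _ := Measure_isFinite.Build _ _ _ convolution
  convolution_fin.

End convolution.

Section empirical.
Context {disp} {T : measurableType disp} {R : realType}.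
Variables (n : nat) (x : 'I_n -> T).

Definition empirical (A : set T) : \bar R :=
  ((n%:R^-1)%:E * \sum_(i < n) \d_(x i) A)%E.

Let empirical0 : empirical set0 = 0%E.
Proof.
by rewrite /empirical big1 ?mule0// => i _; rewrite measure0.
Qed.

Let empirical_ge0 A : (0 <= empirical A)%E.
Proof.
by apply: mule_ge0; [rewrite lee_fin invr_ge0|exact: sume_ge0].
Qed.

Let summand k : {measure set T -> \bar R} :=
  if @insub nat (fun k => k < n)%N 'I_n k is Some i then \d_(x i) else mzero.

Let empirical_sigma_additive : semi_sigma_additive empirical.
Proof.
have r0 : 0 <= n%:R^-1 :> R by rewrite invr_ge0.
rewrite (_ : empirical = mscale (NngNum r0) (msum summand n)).
  exact: measure_semi_sigma_additive.
apply/funext => A; congr (_ * _)%E; apply: eq_bigr => i _.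
by rewrite /summand valK.
Qed.

HB.instance Definition _ := isMeasure.Build _ _ _ empirical
  empirical0 empirical_ge0 empirical_sigma_additive.

Let empirical_fin : fin_num_fun empirical.
Proof.
move=> A mA; apply: fin_numM => //; apply/sum_fin_numP => i _ _.
exact: fin_num_measure.
Qed.

HB.instance Definition _ := Measure_isFinite.Build _ _ _ empirical
  empirical_fin.

End empirical.

Section hellinger.
Context {R : realType} {d : nat}.

Definition hellinger2_density (p q : 'rV[R]_d -> R) : \bar R :=
  (\int[lebesgue_rV d]_x ((Num.sqrt (p x) - Num.sqrt (q x)) ^+ 2)%:E)%E.

Definition lebesgue_density (mu : {finite_measure set 'rV[R]_d -> \bar R})
    (x : 'rV[R]_d) : R :=
  fine (Radon_Nikodym (charge_of_finite_measure mu) (lebesgue_rV d) x).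

(* Meaningful for mu, nu absolutely continuous with respect to Lebesgue *)
(* measure; the integral does not depend on the versions of the densities. *)
Definition hellinger2 (mu nu : {finite_measure set 'rV[R]_d -> \bar R}) :=
  hellinger2_density (lebesgue_density mu) (lebesgue_density nu).

End hellinger.

Section subgaussian_lipschitz_score.
Context {R : realType} {d : nat}.
Implicit Types (rho : probability 'rV[R]_d R) (p : 'rV[R]_d -> R).

Definition dot (u v : 'rV[R]_d) : R := \sum_i u ord0 i * v ord0 i.

(* The library's norm on 'rV[R]_d is the sup norm. *)
Definition norm2 (u : 'rV[R]_d) : R := Num.sqrt (dot u u).

(* If a coordinate is not integrable, its entry here is a junk real number c; *)
(* this is harmless in subgaussian, since exponential moments around any c *)
(* force integrability. *)
Definition mean rho : 'rV[R]_d :=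
  \row_i fine ('E_rho[fun x : 'rV[R]_d => x ord0 i])%E.

Definition subgaussian (alpha : R) rho : Prop := forall theta : 'rV[R]_d,
  ('E_rho[fun x : 'rV[R]_d => expR (dot theta (x - mean rho))]
    <= (expR (alpha ^+ 2 * norm2 theta ^+ 2 / 2))%:E)%E.

Definition full_support rho : Prop :=
  forall U : set 'rV[R]_d, open U -> U !=set0 -> (0 < rho U)%E.

Definition is_density rho p : Prop :=
  [/\ measurable_fun setT p, (forall x, 0 <= p x) &
      forall A, measurable A ->
        rho A = (\int[lebesgue_rV d]_(x in A) (p x)%:E)%E].

Definition score p (x : 'rV[R]_d) : 'rV[R]_d :=
  \row_i 'D_(delta_mx ord0 i) (fun y : 'rV[R]_d => ln (p y)) x.

(* ln is 0 on nonpositive reals, so that the score needs p > 0 everywhere. *)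
Definition lipschitz_score (L : R) p : Prop :=
  [/\ (forall x, 0 < p x),
      (forall x : 'rV[R]_d, differentiable (fun y : 'rV[R]_d => ln (p y)) x) &
      forall x y, norm2 (score p x - score p y) <= L * norm2 (x - y)].

Definition class_P (alpha L : R) rho : Prop :=
  [/\ full_support rho, subgaussian alpha rho &
      exists2 p, is_density rho p & lipschitz_score L p].

End subgaussian_lipschitz_score.

Section iid.
Context {disp dispT} {Omega : measurableType disp} {T : measurableType dispT}.
Context {R : realType} (P : probability Omega R).

(* Taking A i = setT for some of the i gives the product rule for subfamilies. *)
Definition mutually_independent n (X : 'I_n -> {RV P >-> T}) : Prop :=
  forall A : 'I_n -> set T, (forall i, measurable (A i)) ->
    P (\bigcap_i (X i @^-1` A i)) = (\prod_(i < n) P (X i @^-1` A i))%E.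

Definition iid_sample n (X : 'I_n -> {RV P >-> T}) (rho : probability T R) :=
  mutually_independent X /\
  forall i A, measurable A -> distribution P (X i) A = rho A.

End iid.

(* Main.v *)
Require Import Defs.
From mathcomp Require Import all_boot all_order all_algebra.
From mathcomp Require Import all_classical all_reals all_analysis.
From mathcomp Require Import measurable_realfun ring lra.

Import Order.TTheory GRing.Theory Num.Theory.
Import numFieldNormedType.Exports.
Local Open Scope classical_set_scope.
Local Open Scope ring_scope.

(** Write phi(y, z) for the density of N(y, h I) at z, q(z) for the integral of
phi(y, z) against rho(dy), which is the density of the smoothed law rho_h, and
a(z) for the average of phi(X_i, z) over the sample, which is the density of
the smoothed empirical measure. By Tonelli the expected squared Hellinger
distance is the integral over z of E (sqrt a(z) - sqrt q(z))^2. The space is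
split into the box of half-side r around the mean of rho and its complement.

Off the box, (sqrt a - sqrt q)^2 <= a + q and E a = q give the bound 2 q(z)
([empirical_sqrt_le_mean]), whose integral is twice the mass that rho_h puts
outside of the box. As h <= alpha^2, every coordinate of rho_h is subgaussian
with variance proxy 2 alpha^2, so that Chernoff's bound and a union bound over
the 2 d half-spaces yield the mass 2 d exp(- r^2 / (4 alpha^2))
([convolution_box_tail]).

On the box, (sqrt a - sqrt q)^2 <= (a - q)^2 / q, and pairwise independence
bounds E (a - q)^2 by S / n, where S(z) is the integral of phi(y, z)^2 against
rho(dy) ([empirical_sqrt_le_variance]). The heart of the proof is the bound
S(z) <= (2 pi h)^(- d / 2) q(z) ([gauss_density_second_moment_le]), which says
that halving the bandwidth does not increase the smoothed density by more than
the factor 2^(d / 2). A Lipschitz score means that the logarithm of the density p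
of rho stays within L |y - z|^2 / 2 of its tangent at z ([ln_density_taylor]).
Replacing p by its upper model in S and by its lower model in q turns both
into products of integrals of exp(b t - c t^2), with the same slope b, which
is a coordinate of the score at z; the precision c is 1 / h - L / 2 in S and
1 / (2 h) + L / 2 in q. Such an integral is sqrt(pi / c) exp(b^2 / (4 c)),
which decreases in c for every b, and h <= 1 / (4 L) makes the precision in S
the larger one. So the score at z, which may be arbitrarily large, drops out.

The box has volume (2 r)^d, which bounds its contribution by
(2 r / sqrt(2 pi h))^d / n. With r = 2 alpha sqrt(ln n) the mass
outside of the box is 2 d / n, and the universal constant is 8 / pi. *)

(** * Integration against product measures on row vectors *)

Section product.
Context {R : realType}.
Implicit Types mu : {sigma_finite_measure set (measurableTypeR R) -> \bar R}.

Lemma cons_rV0 n x (v : 'rV[R]_n) : cons_rV (x, v) ord0 ord0 = x.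
Proof. by rewrite mxE unlift_none. Qed.

Lemma cons_rVS n x (v : 'rV[R]_n) j : cons_rV (x, v) ord0 (lift ord0 j) = v ord0 j.
Proof. by rewrite mxE liftK. Qed.

(** Tonelli along the recursion that defines [product_rV]; the inductions
on the dimension below go through it. *)
Lemma ge0_integral_cons_rV mu n (f : 'rV[R]_n.+1 -> \bar R) :
  measurable_fun setT f -> (forall v, 0 <= f v)%E ->
  (\int[product_rV mu n.+1]_v f v =
   \int[mu]_x \int[product_rV mu n]_v f (cons_rV (x, v)))%E.
Proof.
move=> mf f0.
rewrite (ge0_integral_pushforward (@measurable_cons_rV R n))//.
rewrite preimage_setT (fubini_tonelli1 (f \o @cons_rV R n))//.
- by apply: measurableT_comp => //; exact: measurable_cons_rV.
- by move=> p; exact: f0.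
Qed.

Lemma measurable_prod_coord n (g : 'I_n -> R -> R) :
  (forall i, measurable_fun setT (g i)) ->
  measurable_fun setT (fun v : 'rV[R]_n => \prod_i g i (v ord0 i)).
Proof.
move=> mg; apply: measurable_prod => i _.
by apply: (measurableT_comp (mg i)); exact: measurable_coord.
Qed.

(** The integrals over the whole space that have to be computed factor over the
coordinates; this reduces them to integrals over the line. *)
Lemma ge0_integral_prod_rV mu n (g : 'I_n -> R -> R) :
  (forall i, measurable_fun setT (g i)) -> (forall i x, 0 <= g i x) ->
  (\int[product_rV mu n]_v (\prod_i g i (v ord0 i))%:E =
   \prod_(i < n) \int[mu]_x (g i x)%:E)%E.
Proof.
elim: n g => [|n IHn] g mg g0.
  rewrite /= integral_dirac//; last first.
    by apply/measurable_EFinP; apply: measurable_prod_coord.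
  by rewrite !big_ord0 diracT mul1e.
rewrite ge0_integral_cons_rV; last 2 first.
- by apply/measurable_EFinP; exact: measurable_prod_coord.
- by move=> v; rewrite lee_fin prodr_ge0.
rewrite big_ord_recl -(IHn (fun j => g (lift ord0 j)))//.
rewrite -ge0_integralZr//; last 3 first.
- by apply/measurable_EFinP; exact: (mg ord0).
- by move=> x _; rewrite lee_fin.
- by apply: integral_ge0 => v _; rewrite lee_fin prodr_ge0.
apply: eq_integral => x _; rewrite -ge0_integralZl//; last 3 first.
- by apply/measurable_EFinP; exact: (@measurable_prod_coord n (fun j => g (lift ord0 j))).
- by move=> v _; rewrite lee_fin prodr_ge0.
- by rewrite lee_fin.
apply: eq_integral => v _; rewrite big_ord_recl cons_rV0 EFinM.
by under [in LHS]eq_bigr do rewrite cons_rVS.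
Qed.

Definition box n (c : 'rV[R]_n) (r : R) : set 'rV[R]_n :=
  [set x | forall i, `|x ord0 i - c ord0 i| <= r].

Lemma measurable_box n (c : 'rV[R]_n) (r : R) : measurable (box n c r).
Proof.
have -> : box n c r = \bigcap_(i in [set: 'I_n])
    ((fun x : 'rV[R]_n => x ord0 i) @^-1` `[c ord0 i - r, c ord0 i + r]).
  apply/seteqP; split=> x /= xr i; first by move=> _; rewrite /= in_itv/= -ler_distl.
  by have := xr i Logic.I; rewrite /= in_itv/= -ler_distl.
apply: fin_bigcap_measurable => // i _.
by rewrite -[X in measurable X]setTI; apply: measurable_coord.
Qed.

Lemma lebesgue_rV_box n (c : 'rV[R]_n) (r : R) : 0 <= r ->
  lebesgue_rV n (box n c r) = ((2 * r) ^+ n)%:E.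
Proof.
move=> r0; pose I i : set R := `[c ord0 i - r, c ord0 i + r]%classic.
have mI i : measurable (I i) by exact: measurable_itv.
(* The indicator of the box is the product of the indicators of its sides. *)
transitivity (\int[@lebesgue_rV R n]_v (\prod_i (\1_(I i) (v ord0 i) : R))%:E)%E; last first.
  rewrite /lebesgue_rV (ge0_integral_prod_rV _ n (fun i => \1_(I i)))//.
  rewrite (eq_bigr (fun=> (2 * r)%:E)) => [|i _]; last first.
    transitivity (@lebesgue_measure R (I i)).
      rewrite integral_indic; [|exact: measurableT|exact: mI].
      by rewrite (_ : I i `&` _ = I i)//; exact: setIT.
    rewrite /I lebesgue_measure_itv/= lte_fin -EFinB.
    by case: ltP => h; congr EFin; [ring|lra].
  by rewrite prodEFin prodr_const card_ord.
rewrite -[X in lebesgue_rV n X]setIT -integral_indic//; last exact: measurable_box.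
apply: eq_integral => x _; congr EFin.
rewrite indicE; case: (asboolP (box n c r x)) => [xr|xr].
  rewrite mem_set// big1// => i _; rewrite indicE mem_set// /I/= in_itv/= -ler_distl.
  exact: xr.
rewrite memNset//; move/existsNP : xr => [i /negP xi].
rewrite (bigD1 i)//= indicE memNset ?mul0r// /I/= in_itv/= -ler_distl.
exact/negP.
Qed.
End product.

(** * Densities and Radon-Nikodym derivatives *)

Section density.
Context {R : realType} {d : measure_display} {T : measurableType d}.
Variables (nu : {finite_measure set T -> \bar R})
          (mu : {sigma_finite_measure set T -> \bar R}) (p : T -> R).
Hypotheses (mp : measurable_fun setT p) (p0 : forall x, 0 <= p x).
Hypothesis nup : forall A, measurable A ->
  nu A = (\int[mu]_(x in A) (p x)%:E)%E.

Lemma density_dominates : nu `<< mu.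
Proof.
apply/null_content_dominatesP => A mA muA0; rewrite nup//.
apply: null_set_integral => //.
by apply: measurable_funTS; exact/measurable_EFinP.
Qed.

(** Lets an explicit density replace the Radon-Nikodym derivative, which is an
arbitrary representative of its almost everywhere class, under an integral. *)
Lemma ae_eq_Radon_Nikodym_density :
  ae_eq mu setT (Radon_Nikodym (charge_of_finite_measure nu) mu) (EFin \o p).
Proof.
apply: integral_ae_eq => //.
- by apply: Radon_Nikodym_integrable; exact: density_dominates.
- exact/measurable_EFinP.
- move=> A _ mA; rewrite -Radon_Nikodym_integral//; last exact: density_dominates.
  exact: nup.
Qed.

Lemma ge0_integral_density (f : T -> \bar R) :
  measurable_fun setT f -> (forall x, 0 <= f x)%E ->
  (\int[nu]_x f x = \int[mu]_x (f x * (p x)%:E))%E.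
Proof.
move=> mf f0; have numu := density_dominates.
rewrite -(Radon_Nikodym_SigmaFinite.change_of_variables numu)//.
have mRN : measurable_fun setT (Radon_Nikodym_SigmaFinite.f nu mu).
  exact: measurable_int (Radon_Nikodym_SigmaFinite.f_integrable numu).
apply: ge0_ae_eq_integral => //.
- exact: emeasurable_funM.
- by apply: emeasurable_funM => //; exact/measurable_EFinP.
- by move=> x _; apply: mule_ge0 => //; exact: Radon_Nikodym_SigmaFinite.f_ge0.
- by move=> x _; apply: mule_ge0 => //; rewrite lee_fin.
apply: ae_eqe_mul2l; apply: integral_ae_eq => //.
- exact: Radon_Nikodym_SigmaFinite.f_integrable.
- exact/measurable_EFinP.
- by move=> A _ mA; rewrite -Radon_Nikodym_SigmaFinite.f_integral// nup.
Qed.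

End density.

(** * Translations and the Gaussian density *)

Section shift.
Context {R : realType}.
Local Notation leb := (@lebesgue_measure R).

Lemma lebesgue_measure_shift (a : R) (A : set R) : measurable A ->
  pushforward leb ((+%R^~ a) : _ -> measurableTypeR R) A = leb A.
Proof.
move=> mA.
have ms : measurable_fun setT ((+%R^~ a) : measurableTypeR R -> measurableTypeR R).
  exact: measurable_funD.
apply/esym; apply: lebesgue_measure_unique mA => _ [[u v]] _ <- /=.
rewrite /pushforward.
have -> : (+%R^~ a) @^-1` `]u, v] = `]u - a, v - a]%classic.
  by apply/seteqP; split=> x /=; rewrite !in_itv/= ltrBlDr lerBrDr.
rewrite !lebesgue_measure_itv/= !lte_fin ltrD2r.
by case: ifP => // _; rewrite -!EFinB opprB addrA subrK.
Qed.
End shift.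

Section gaussian.
Context {R : realType}.
Local Notation leb := (@lebesgue_measure R).

Lemma ge0_integral_shift (a : R) (f : R -> \bar R) :
  measurable_fun setT f -> (forall x, 0 <= f x)%E ->
  (\int[leb]_x f (x + a)%R = \int[leb]_x f x)%E.
Proof.
move=> mf f0.
have ms : measurable_fun setT ((+%R^~ a) : measurableTypeR R -> measurableTypeR R).
  exact: measurable_funD.
transitivity (\int[pushforward leb
    ((+%R^~ a) : measurableTypeR R -> measurableTypeR R)]_x f x)%E.
  by rewrite ge0_integral_pushforward.
by apply: eq_measure_integral => A mA _; exact: lebesgue_measure_shift.
Qed.

Lemma measurable_add_rV n :
  measurable_fun setT (fun p : 'rV[R]_n * 'rV[R]_n => p.1 + p.2).
Proof.
apply: measurable_fun_rV => i; under eq_fun do rewrite mxE.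
by apply: measurable_funD; apply: (measurableT_comp (measurable_coord i)).
Qed.

Lemma measurable_shift_rV n (a : 'rV[R]_n) :
  measurable_fun setT (fun x : 'rV[R]_n => x + a).
Proof.
apply: measurable_fun_rV => i; under eq_fun do rewrite mxE.
by apply: measurable_funD => //; exact: measurable_coord.
Qed.

(** Induction on the dimension: the head and the tail of the vector are
translated separately. *)
Lemma ge0_integral_shift_rV n (a : 'rV[R]_n) (f : 'rV[R]_n -> \bar R) :
  measurable_fun setT f -> (forall x, 0 <= f x)%E ->
  (\int[lebesgue_rV n]_x f (x + a)%R = \int[lebesgue_rV n]_x f x)%E.
Proof.
elim: n a f => [|n IHn] a f mf f0.
  by apply: eq_integral => x _; congr f; apply/rowP => -[].
rewrite /lebesgue_rV (ge0_integral_cons_rV _ n f)//.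
rewrite (ge0_integral_cons_rV _ n (fun x => f (x + a)))//; last first.
  by apply: (measurableT_comp mf); exact: measurable_shift_rV.
pose a' : 'rV[R]_n := \row_j a ord0 (lift ord0 j).
have mc : measurable_fun setT (f \o @cons_rV R n).
  by apply: (measurableT_comp mf); exact: measurable_cons_rV.
transitivity (\int[leb]_x \int[lebesgue_rV n]_v f (cons_rV ((x + a ord0 ord0)%R, v)))%E.
  apply: eq_integral => x _.
  rewrite -(IHn a' (fun v => f (cons_rV ((x + a ord0 ord0)%R, v))))//; last first.
    exact: (measurableT_comp mc (measurable_pair1 _)).
  apply: eq_integral => v _; congr f; apply/rowP => i.
  by rewrite mxE; case: (unliftP ord0 i) => [j|] ->;
    rewrite ?cons_rV0 ?cons_rVS ?mxE.
have mF : measurable_fun setT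
    (fun x : measurableTypeR R => \int[lebesgue_rV n]_v f (cons_rV (x, v)))%E.
  by apply: (measurable_fun_fubini_tonelli_F (f \o @cons_rV R n)) => // p; exact: f0.
rewrite (ge0_integral_shift (a ord0 ord0)
  (fun x => \int[lebesgue_rV n]_v f (cons_rV (x, v)))%E)//.
by move=> x; apply: integral_ge0.
Qed.

(** The parameter h is the variance of a coordinate, whereas [normal_pdf]
takes a standard deviation. *)
Definition gauss_density n (h : R) (m x : 'rV[R]_n) : R :=
  \prod_i normal_pdf (m ord0 i) (Num.sqrt h) (x ord0 i).

Lemma gauss_density_ge0 n h (m x : 'rV[R]_n) : 0 <= gauss_density n h m x.
Proof. by apply: prodr_ge0 => i _; exact: normal_pdf_ge0. Qed.

Lemma measurable_gauss_density n h (m : 'rV[R]_n) :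
  measurable_fun setT (gauss_density n h m).
Proof.
exact: (measurable_prod_coord n (fun i => normal_pdf (m ord0 i) (Num.sqrt h))
  (fun i => measurable_normal_pdf _ _)).
Qed.

Lemma ge0_integral_gaussian_rV n h (f : 'rV[R]_n -> \bar R) :
  measurable_fun setT f -> (forall x, 0 <= f x)%E ->
  (\int[gaussian_rV n h]_x f x =
   \int[lebesgue_rV n]_x (f x * (gauss_density n h 0 x)%:E))%E.
Proof.
elim: n f => [|n IHn] f mf f0.
  by apply: eq_integral => x _; rewrite /gauss_density big_ord0 mule1.
rewrite /lebesgue_rV /gaussian_rV !ge0_integral_cons_rV//; last 2 first.
- apply: emeasurable_funM => //; apply/measurable_EFinP.
  exact: measurable_gauss_density.
- by move=> x; apply: mule_ge0 => //; rewrite lee_fin gauss_density_ge0.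
have mc : measurable_fun setT (f \o @cons_rV R n).
  by apply: (measurableT_comp mf); exact: measurable_cons_rV.
have mF : measurable_fun setT
    (fun x : measurableTypeR R => \int[gaussian_rV n h]_v f (cons_rV (x, v)))%E.
  by apply: (measurable_fun_fubini_tonelli_F (f \o @cons_rV R n)) => // p; exact: f0.
rewrite (@ge0_integral_density _ _ _ (normal_prob 0 (Num.sqrt h)) leb
  (normal_pdf 0 (Num.sqrt h)))//; last 3 first.
- exact: measurable_normal_pdf.
- exact: normal_pdf_ge0.
- by move=> x; apply: integral_ge0.
apply: eq_integral => x _.
rewrite (IHn (fun v => f (cons_rV (x, v))))//; last first.
  exact: (measurableT_comp mc (measurable_pair1 _)).
rewrite -ge0_integralZr//; last 3 first.
- apply: emeasurable_funM; first exact: (measurableT_comp mc (measurable_pair1 _)).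
  by apply/measurable_EFinP; exact: measurable_gauss_density.
- by move=> v _; apply: mule_ge0 => //; rewrite lee_fin gauss_density_ge0.
- by rewrite lee_fin normal_pdf_ge0.
apply: eq_integral => v _; rewrite -muleA -EFinM; congr (_ * _%:E)%E.
rewrite /gauss_density big_ord_recl cons_rV0 mxE mulrC; congr (_ * _).
by apply: eq_bigr => i _; rewrite cons_rVS !mxE.
Qed.

End gaussian.

(** * Gaussian smoothing of a finite measure *)

Section smoothing.
Context {R : realType} {d : nat}.
Variable h : R.
Hypothesis h0 : 0 < h.
Local Notation phi := (@gauss_density R d h).
Local Notation s := (Num.sqrt h).

Let s0 : s != 0. Proof. by rewrite gt_eqF// sqrtr_gt0. Qed.

Lemma gauss_density_le m x : phi m x <= normal_peak s ^+ d.
Proof.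
rewrite -[d in _ ^+ d]card_ord -prodr_const; apply: ler_prod => i _.
by rewrite normal_pdf_ge0 normal_pdf_ub.
Qed.

Lemma gauss_densityC m x : phi m x = phi x m.
Proof.
apply: eq_bigr => i _; rewrite !normal_pdfE// /normal_fun.
by rewrite -(opprB (x ord0 i)) sqrrN.
Qed.

Lemma gauss_density_shift m x : phi m (x + m) = phi 0 x.
Proof.
apply: eq_bigr => i _; rewrite !normal_pdfE// /normal_fun !mxE.
by rewrite addrK subr0.
Qed.

Lemma measurable_gauss_density2 :
  measurable_fun setT (fun p : 'rV[R]_d * 'rV[R]_d => phi p.1 p.2).
Proof.
apply: measurable_prod => i _ /=.
under eq_fun do rewrite normal_pdfE//.
apply: measurable_funM => //; apply: measurableT_comp => //.
apply: measurable_funM => //; apply: measurableT_comp => //.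
apply: measurable_funX; apply: measurable_funB.
  exact: (measurableT_comp (measurable_coord i) measurable_snd).
exact: (measurableT_comp (measurable_coord i) measurable_fst).
Qed.

Lemma measurable_gauss_densityr x : measurable_fun setT (phi ^~ x).
Proof. exact: (measurableT_comp measurable_gauss_density2 (measurable_pair2 x)). Qed.

Variable mu : {finite_measure set 'rV[R]_d -> \bar R}.

(** The density of the convolution of mu with N(0, h I). Taking [fine] loses
nothing, because the Gaussian kernel is bounded and mu is finite. *)
Definition smoothed (x : 'rV[R]_d) : R := fine (\int[mu]_y (phi y x)%:E)%E.

Lemma smoothedE x : (smoothed x)%:E = (\int[mu]_y (phi y x)%:E)%E.
Proof.
rewrite fineK// ge0_fin_numE; last first.
  by apply: integral_ge0 => y _; rewrite lee_fin gauss_density_ge0.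
apply: (@le_lt_trans _ _ (\int[mu]_y (normal_peak s ^+ d)%:E)%E).
  apply: ge0_le_integral => //.
  - by move=> y _; rewrite lee_fin gauss_density_ge0.
  - by apply/measurable_EFinP; exact: measurable_gauss_densityr.
  - by move=> y _; rewrite lee_fin gauss_density_le.
by rewrite integral_cst// lte_mul_pinfty ?lee_fin ?exprn_ge0 ?normal_peak_ge0//
  ltey_eq fin_num_measure.
Qed.

Lemma smoothed_ge0 x : 0 <= smoothed x.
Proof.
by apply: fine_ge0; apply: integral_ge0 => y _; rewrite lee_fin gauss_density_ge0.
Qed.

Lemma measurable_smoothed : measurable_fun setT smoothed.
Proof.
apply: measurableT_comp; first exact: fine_measurable.
apply: (measurable_fun_fubini_tonelli_G
  (fun p : 'rV[R]_d * 'rV[R]_d => (phi p.1 p.2)%:E)).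
- by apply/measurable_EFinP; exact: measurable_gauss_density2.
- by move=> p; rewrite lee_fin gauss_density_ge0.
Qed.

(** For a fixed point y of the first factor, translating the Gaussian variable
by y turns the centered density into the one centered at y; Tonelli then
exchanges y and the point at which the density is evaluated. *)
Lemma convolution_gaussianE A : measurable A ->
  convolution mu (gaussian_rV d h) A =
  (\int[lebesgue_rV d]_(x in A) (smoothed x)%:E)%E.
Proof.
move=> mA.
have madd := @measurable_add_rV R d.
have mI : measurable_fun setT (fun x : 'rV[R]_d => (\1_A x)%:E : \bar R).
  by apply/measurable_EFinP; exact: measurable_indic.
have mIA : measurable_fun setT
    (fun p : 'rV[R]_d * 'rV[R]_d => (\1_A (p.1 + p.2)%R)%:E : \bar R).
  exact: (measurableT_comp mI madd).
transitivity (\int[mu \x gaussian_rV d h]_p (\1_A (p.1 + p.2)%R)%:E)%E.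
  have mpre : measurable ((fun p : 'rV[R]_d * 'rV[R]_d => p.1 + p.2) @^-1` A).
    by rewrite -[X in measurable X]setTI; exact: madd.
  have /esym := integral_indic (mu \x gaussian_rV d h)%E measurableT mpre.
  by rewrite setIT.
rewrite (fubini_tonelli1 (fun p : 'rV[R]_d * 'rV[R]_d => (\1_A (p.1 + p.2)%R)%:E))//.
transitivity (\int[mu]_y \int[lebesgue_rV d]_x
    ((\1_A x)%:E * (phi y x)%:E))%E.
  apply: eq_integral => y _; rewrite /fubini_F.
  transitivity (\int[gaussian_rV d h]_z (\1_A (y + z)%R)%:E)%E.
    by [].
  rewrite ge0_integral_gaussian_rV; last 2 first.
  - exact: (measurableT_comp mIA (measurable_pair1 y)).
  - by move=> z; rewrite lee_fin.
  transitivity (\int[lebesgue_rV d]_x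
      ((\1_A (x + y)%R)%:E * (phi y (x + y)%R)%:E))%E.
    by apply: eq_integral => z _; rewrite gauss_density_shift addrC.
  apply: (ge0_integral_shift_rV d y (fun x => (\1_A x)%:E * (phi y x)%:E)%E).
  - apply: emeasurable_funM => //; apply/measurable_EFinP.
    exact: measurable_gauss_density.
  - by move=> x; apply: mule_ge0; rewrite lee_fin ?gauss_density_ge0.
rewrite (fubini_tonelli (fun p => (\1_A p.2)%:E * (phi p.1 p.2)%:E)%E)/=; last 2 first.
- apply: emeasurable_funM.
    exact: (measurableT_comp mI measurable_snd).
  by apply/measurable_EFinP; exact: measurable_gauss_density2.
- by move=> p; apply: mule_ge0; rewrite lee_fin ?gauss_density_ge0.
rewrite [RHS]integral_mkcond; apply: eq_integral => x _.
rewrite ge0_integralZl//; last 2 first.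
- by apply/measurable_EFinP; exact: measurable_gauss_densityr.
- by move=> y _; rewrite lee_fin gauss_density_ge0.
by rewrite -smoothedE epatch_indic muleC.
Qed.
End smoothing.

Section sqrt_diff.
Context {R : realType} {disp : measure_display} {T : measurableType disp}.

Lemma measurable_sqrtr : measurable_fun setT (fun x : R => Num.sqrt x).
Proof. by apply: continuous_measurable_fun; exact: sqrt_continuous. Qed.

Lemma measurable_sqr_sqrtB (p q : T -> R) :
  measurable_fun setT p -> measurable_fun setT q ->
  measurable_fun setT (fun x => ((Num.sqrt (p x) - Num.sqrt (q x)) ^+ 2)%:E).
Proof.
move=> mp mq; apply/measurable_EFinP; apply: measurable_funX.
by apply: measurable_funB; exact: (measurableT_comp measurable_sqrtr).
Qed.

End sqrt_diff.

Section hellinger_convolution.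
Context {R : realType} {d : nat}.
Variable h : R.
Hypothesis h0 : 0 < h.

(** On the left, the densities are Radon-Nikodym derivatives chosen separately
for each measure, so that nothing can be said on how they depend on mu. The
explicit kernel averages on the right depend on a sample in a jointly
measurable way. *)
Lemma hellinger2_convolution_gaussian
    (mu nu : {finite_measure set 'rV[R]_d -> \bar R}) :
  hellinger2 (convolution mu (gaussian_rV d h))
             (convolution nu (gaussian_rV d h)) =
  hellinger2_density (smoothed h mu) (smoothed h nu).
Proof.
have mdens (la : {finite_measure set 'rV[R]_d -> \bar R}) :
    la `<< lebesgue_rV d -> measurable_fun setT (Defs.lebesgue_density la).
  move=> lad; apply: measurableT_comp; first exact: fine_measurable.
  by apply: measurable_int; apply: Radon_Nikodym_integrable; exact: lad.
have dens la := @density_dominates _ _ _ (convolution la (gaussian_rV d h))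
  (lebesgue_rV d) (smoothed h la) (measurable_smoothed h h0 la)
  (convolution_gaussianE h h0 la).
have aedens la := @ae_eq_Radon_Nikodym_density _ _ _ (convolution la (gaussian_rV d h))
  (lebesgue_rV d) (smoothed h la) (measurable_smoothed h h0 la)
  (convolution_gaussianE h h0 la).
apply: ge0_ae_eq_integral => //.
- apply: measurable_sqr_sqrtB; apply: mdens; exact: dens.
- apply: measurable_sqr_sqrtB; exact: measurable_smoothed.
- by move=> x _; rewrite lee_fin sqr_ge0.
- by move=> x _; rewrite lee_fin sqr_ge0.
apply: filterS2 (aedens mu) (aedens nu) => x mux nux _.
by rewrite /Defs.lebesgue_density (mux I) (nux I).
Qed.
End hellinger_convolution.

(** * Moments of independent samples *)

Section iid_moments.
Context {disp dispT : measure_display} {Omega : measurableType disp}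
  {T : measurableType dispT} {R : realType}.
Variables (P : probability Omega R) (n : nat) (X : 'I_n -> {RV P >-> T})
  (rho : probability T R).
Hypothesis Xrho : iid_sample X rho.

Lemma iid_prob i A : measurable A -> P (X i @^-1` A) = rho A.
Proof. by move=> mA; rewrite -(Xrho.2 i). Qed.

Lemma iid_integral i (f : T -> \bar R) :
  measurable_fun setT f -> (forall x, 0 <= f x)%E ->
  (\int[P]_w f (X i w) = \int[rho]_x f x)%E.
Proof.
move=> mf f0.
transitivity (\int[pushforward P (X i)]_x f x)%E.
  by rewrite ge0_integral_pushforward.
by apply: eq_measure_integral => A mA _; exact: Xrho.2.
Qed.

(** The product rule of the whole family, with trivial events at the indices
other than i and j. *)
Lemma iid_prob_pair i j A B : i != j -> measurable A -> measurable B ->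
  P (X i @^-1` A `&` X j @^-1` B) = (rho A * rho B)%E.
Proof.
move=> ij mA mB.
pose F k := if k == i then A else if k == j then B else setT.
have mF k : measurable (F k) by rewrite /F; case: ifP => // _; case: ifP.
have -> : X i @^-1` A `&` X j @^-1` B = \bigcap_k (X k @^-1` F k).
  apply/seteqP; split => w /=.
    move=> [Aw Bw] k _; rewrite /F /=; case: eqP => [->//|_].
    by case: eqP => [->//|_].
  move=> Fw; split; first by have := Fw i Logic.I; rewrite /F/= eqxx.
  by have := Fw j Logic.I; rewrite /F/= eqxx eq_sym (negbTE ij).
rewrite Xrho.1// (bigD1 i)//= (bigD1 j)/=; last by rewrite eq_sym.
rewrite big1 => [|k /andP[ki kj]]; last first.
  by rewrite /F (negbTE ki) (negbTE kj) preimage_setT probability_setT.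
by rewrite mule1 /F !eqxx eq_sym (negbTE ij) !iid_prob.
Qed.

(** The joint law of (X i, X j) agrees with the product measure on rectangles,
hence everywhere. *)
Lemma iid_integral_pair i j (f g : T -> \bar R) : i != j ->
  measurable_fun setT f -> (forall x, 0 <= f x)%E ->
  measurable_fun setT g -> (forall x, 0 <= g x)%E ->
  (\int[P]_w (f (X i w) * g (X j w)) =
   (\int[rho]_x f x) * (\int[rho]_x g x))%E.
Proof.
move=> ij mf f0 mg g0.
pose XY w := (X i w, X j w).
have mXY : measurable_fun setT XY by exact: measurable_fun_pair.
have mfg : measurable_fun setT (fun p : T * T => f p.1 * g p.2)%E.
  apply: emeasurable_funM; first exact: (measurableT_comp mf measurable_fst).
  exact: (measurableT_comp mg measurable_snd).
have fg0 (p : T * T) : (0 <= f p.1 * g p.2)%E by exact: mule_ge0.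
transitivity (\int[pushforward P XY]_p (f p.1 * g p.2))%E.
  by rewrite ge0_integral_pushforward.
transitivity (\int[rho \x rho]_p (f p.1 * g p.2))%E.
  apply: eq_measure_integral => C mC _; apply/esym.
  apply: product_measure_unique mC => A B mA mB.
  by rewrite -(iid_prob_pair i j).
rewrite (fubini_tonelli1 (fun p : T * T => f p.1 * g p.2)%E)// /fubini_F/=.
rewrite -ge0_integralZr//; last exact: integral_ge0.
by apply: eq_integral => x _; rewrite ge0_integralZl.
Qed.

End iid_moments.

Section empirical_integral.
Context {disp : measure_display} {T : measurableType disp} {R : realType}.

Lemma ge0_integral_empirical n (x : 'I_n -> T) (f : T -> \bar R) :
  measurable_fun setT f -> (forall y, 0 <= f y)%E ->
  (\int[empirical x]_y f y = (n%:R^-1)%:E * \sum_(i < n) f (x i))%E.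
Proof.
move=> mf f0.
(* [msum] takes measures indexed by nat, hence a default value from n on. *)
pose m k : {measure set T -> \bar R} :=
  if @insub nat (fun k => k < n)%N 'I_n k is Some i then \d_(x i) else mzero.
have r0 : 0 <= n%:R^-1 :> R by rewrite invr_ge0.
transitivity (\int[mscale (NngNum r0) (msum m n)]_y f y)%E.
  apply: eq_measure_integral => A mA _; congr (_ * _)%E.
  by apply: eq_bigr => i _; rewrite /m valK.
rewrite ge0_integral_mscale//=; congr (_ * _)%E.
rewrite ge0_integral_measure_sum//; apply: eq_bigr => i _.
by rewrite /m valK integral_dirac// diracT mul1e.
Qed.

End empirical_integral.

(** * Square roots of empirical averages *)

Section empirical_sqrt.
Context {disp dispT : measure_display} {Omega : measurableType disp}
  {T : measurableType dispT} {R : realType}.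
Variables (P : probability Omega R) (n : nat) (X : 'I_n -> {RV P >-> T})
  (rho : probability T R).
Hypotheses (Xrho : iid_sample X rho) (n0 : (0 < n)%N).
Variables (k : T -> R) (q : R).
Hypotheses (mk : measurable_fun setT k) (k0 : forall y, 0 <= k y).
Hypothesis qE : (\int[rho]_y (k y)%:E)%E = q%:E.

Let avg (w : Omega) : R := n%:R^-1 * \sum_(i < n) k (X i w).

Let avg0 w : 0 <= avg w.
Proof. by rewrite mulr_ge0 ?invr_ge0// sumr_ge0. Qed.

Let mkX i : measurable_fun setT (fun w => k (X i w)).
Proof. exact: (measurableT_comp mk). Qed.

Let mavg : measurable_fun setT avg.
Proof. by apply: measurable_funM => //; apply: measurable_sum => i. Qed.

Let q0 : 0 <= q.
Proof. by rewrite -lee_fin -qE; apply: integral_ge0 => y _; rewrite lee_fin. Qed.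

Let nR0 : n%:R != 0 :> R. Proof. by rewrite pnatr_eq0 -lt0n. Qed.

Let msqrt : measurable_fun setT
  (fun w => ((Num.sqrt (avg w) - Num.sqrt q) ^+ 2)%:E : \bar R).
Proof. exact: measurable_sqr_sqrtB. Qed.

Let integral_cst_prob (c : \bar R) : (\int[P]__ c = c)%E.
Proof.
rewrite (integral_cst P measurableT) -[RHS]mule1.
by congr (_ * _)%E; exact: probability_setT.
Qed.

Lemma expectation_empirical : (\int[P]_w (avg w)%:E)%E = q%:E.
Proof.
under eq_integral do rewrite /avg EFinM.
rewrite ge0_integralZl//; last 2 first.
- by apply/measurable_EFinP; apply: measurable_sum => i.
- by move=> w _; rewrite lee_fin sumr_ge0.
under eq_integral do rewrite -sumEFin.
rewrite ge0_integral_sum//; last 2 first.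
- by move=> i; exact/measurable_EFinP.
- by move=> i w _; rewrite lee_fin.
rewrite (eq_bigr (fun=> q%:E)) => [|i _]; last first.
  by rewrite (iid_integral P n X rho Xrho i (EFin \o k))//; exact/measurable_EFinP.
by rewrite sumEFin sumr_const card_ord -[q *+ n]mulr_natl -EFinM mulKf.
Qed.

(** From (sqrt a - sqrt q)^2 <= a + q. This ignores any concentration of the
average, and is meant for the points where q is small. *)
Lemma empirical_sqrt_le_mean :
  (\int[P]_w ((Num.sqrt (avg w) - Num.sqrt q) ^+ 2)%:E <= (2 * q)%:E)%E.
Proof.
apply: (@le_trans _ _ (\int[P]_w ((avg w)%:E + q%:E))%E).
  apply: ge0_le_integral => //.
  - by move=> w _; rewrite lee_fin sqr_ge0.
  - by apply: emeasurable_funD => //; exact/measurable_EFinP.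
  - move=> w _; rewrite -EFinD lee_fin sqrrB !sqr_sqrtr//.
    by rewrite addrAC gerBl mulrn_wge0// mulr_ge0 ?sqrtr_ge0.
rewrite ge0_integralD//; [|by move=> w _; rewrite lee_fin|exact/measurable_EFinP].
rewrite expectation_empirical integral_cst_prob.
by rewrite -EFinD lee_fin mulr_natl mulr2n.
Qed.

(** Extended real integrals of nonnegative functions are additive, but not
subtractive: the variance is extracted from (a - q)^2 + 2 q a = a^2 + q^2,
whose terms are all nonnegative. *)
Lemma empirical_variance (S : R) : (\int[rho]_y (k y ^+ 2)%:E)%E = S%:E ->
  (\int[P]_w ((avg w - q) ^+ 2)%:E)%E = (n%:R^-1 * (S - q ^+ 2))%:E.
Proof.
move=> SE.
have EE i j : (\int[P]_w (k (X i w) * k (X j w))%:E =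
    (if i == j then S else q ^+ 2)%:E)%E.
  case: eqP => [->|/eqP ij].
    rewrite -SE -(iid_integral P n X rho Xrho j (fun y => (k y ^+ 2)%:E))//.
    - by apply/measurable_EFinP; exact: measurable_funX.
    - by move=> x; rewrite lee_fin sqr_ge0.
  under eq_integral do rewrite EFinM.
  have mEk : measurable_fun setT (EFin \o k) by exact/measurable_EFinP.
  rewrite (iid_integral_pair P n X rho Xrho i j (EFin \o k) (EFin \o k))//.
  by rewrite qE -EFinM expr2.
have mkk i j : measurable_fun setT (fun w => (k (X i w) * k (X j w))%:E : \bar R).
  by apply/measurable_EFinP; exact: measurable_funM.
have E2 : (\int[P]_w (avg w ^+ 2)%:E)%E =
    (n%:R^-1 ^+ 2 * (n%:R * (S + (n%:R - 1) * q ^+ 2)))%:E.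
  transitivity (\int[P]_w ((n%:R^-1 ^+ 2)%:E *
      (\sum_(i < n) \sum_(j < n) k (X i w) * k (X j w))%:E))%E.
    apply: eq_integral => w _.
    by rewrite -EFinM /avg exprMn [X in _ * X]expr2 big_distrlr.
  rewrite ge0_integralZl//; last 2 first.
  - apply/measurable_EFinP; apply: measurable_sum => i; apply: measurable_sum => j.
    exact: measurable_funM.
  - by move=> w _; rewrite lee_fin !sumr_ge0// => i _;
    rewrite sumr_ge0// => j _; rewrite mulr_ge0.
  rewrite [RHS]EFinM; congr (_ * _)%E.
  under eq_integral do rewrite -sumEFin.
  rewrite ge0_integral_sum//; last 2 first.
  - move=> i; apply/measurable_EFinP; apply: measurable_sum => j.
    exact: measurable_funM.
  - by move=> i w _; rewrite lee_fin sumr_ge0// => j _; rewrite mulr_ge0.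
  rewrite (eq_bigr (fun=> (S + (n%:R - 1) * q ^+ 2)%:E)) => [|i _]; last first.
    under eq_integral do rewrite -sumEFin.
    rewrite ge0_integral_sum//; last by move=> j w _; rewrite lee_fin mulr_ge0.
    under eq_bigr do rewrite EE.
    rewrite sumEFin (bigD1 i)//= eqxx; congr ((_ + _)%:E).
    rewrite (eq_bigr (fun=> q ^+ 2)) => [|j ji]; last by rewrite eq_sym (negbTE ji).
    rewrite sumr_const cardC1 card_ord -[n in RHS](prednK n0) -natr1 addrK.
    by rewrite mulr_natl.
  by rewrite sumEFin sumr_const card_ord mulr_natl.
(* This is the integral of (a - q)^2 + 2 q a = a^2 + q^2. *)
have VE : (\int[P]_w ((avg w - q) ^+ 2)%:E + (2 * q * q)%:E =
    (n%:R^-1 ^+ 2 * (n%:R * (S + (n%:R - 1) * q ^+ 2)) + q ^+ 2)%:E)%E.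
  rewrite [in RHS]EFinD -E2.
  have -> : (q ^+ 2)%:E = (\int[P]_w (q ^+ 2)%:E)%E.
    by rewrite integral_cst_prob.
  rewrite -ge0_integralD//; last 3 first.
  - by move=> w _; rewrite lee_fin sqr_ge0.
  - by apply/measurable_EFinP; exact: measurable_funX.
  - by move=> w _; rewrite lee_fin sqr_ge0.
  rewrite (EFinM (2 * q)) -[in LHS]expectation_empirical -ge0_integralZl//; last 3 first.
  - exact/measurable_EFinP.
  - by move=> w _; rewrite lee_fin.
  - by rewrite lee_fin mulr_ge0.
  rewrite -ge0_integralD//; last 4 first.
  - by move=> w _; rewrite lee_fin sqr_ge0.
  - by apply/measurable_EFinP; apply: measurable_funX; exact: measurable_funB.
  - by move=> w _; rewrite -EFinM lee_fin; apply: mulr_ge0 => //; rewrite mulr_ge0.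
  - by apply: emeasurable_funM => //; exact/measurable_EFinP.
  apply: eq_integral => w _; rewrite -EFinM -!EFinD; congr EFin; ring.
have -> : (\int[P]_w ((avg w - q) ^+ 2)%:E =
    (n%:R^-1 ^+ 2 * (n%:R * (S + (n%:R - 1) * q ^+ 2)) + q ^+ 2)%:E - (2 * q * q)%:E)%E.
  by rewrite -VE addeK.
by rewrite -EFinB; congr EFin; field.
Qed.

(** From (sqrt a - sqrt q)^2 <= (a - q)^2 / q, which holds because a - q is the
product of sqrt a - sqrt q and sqrt a + sqrt q. The second moment is compared
to q so that the division by q cancels. *)
Lemma empirical_sqrt_le_variance (K : R) : 0 <= K ->
  (\int[rho]_y (k y ^+ 2)%:E <= (K * q)%:E)%E ->
  (\int[P]_w ((Num.sqrt (avg w) - Num.sqrt q) ^+ 2)%:E <= (K / n%:R)%:E)%E.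
Proof.
move=> K0 SK.
(* Dividing by q requires q != 0; otherwise the average vanishes almost surely. *)
have [qE0|qn0] := eqVneq q 0.
  apply: (le_trans empirical_sqrt_le_mean).
  by rewrite qE0 mulr0 lee_fin divr_ge0.
have qp : 0 < q by rewrite lt_neqAle eq_sym qn0.
have [S SE] : exists S, (\int[rho]_y (k y ^+ 2)%:E)%E = S%:E.
  exists (fine (\int[rho]_y (k y ^+ 2)%:E)%E); rewrite fineK//.
  rewrite ge0_fin_numE ?(le_lt_trans SK) ?ltry//.
  by apply: integral_ge0 => y _; rewrite lee_fin sqr_ge0.
apply: (@le_trans _ _ (\int[P]_w ((q^-1)%:E * ((avg w - q) ^+ 2)%:E))%E).
  apply: ge0_le_integral => //.
  - by move=> w _; rewrite lee_fin sqr_ge0.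
  - apply: emeasurable_funM => //; apply/measurable_EFinP; apply: measurable_funX.
    exact: measurable_funB.
  move=> w _; rewrite -EFinM lee_fin ler_pdivlMl//.
  have -> : (avg w - q) ^+ 2 = (Num.sqrt (avg w) ^+ 2 - Num.sqrt q ^+ 2) ^+ 2.
    by rewrite !sqr_sqrtr.
  rewrite subr_sqr exprMn [leLHS]mulrC ler_wpM2l ?sqr_ge0//.
  rewrite -[leLHS](sqr_sqrtr q0) lerXn2r ?nnegrE ?addr_ge0 ?sqrtr_ge0//.
  by rewrite lerDr sqrtr_ge0.
rewrite ge0_integralZl//; last 3 first.
- by apply/measurable_EFinP; apply: measurable_funX; exact: measurable_funB.
- by move=> w _; rewrite lee_fin sqr_ge0.
- by rewrite lee_fin invr_ge0.
rewrite (empirical_variance S SE) -EFinM lee_fin.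
move: SK; rewrite SE lee_fin => SK.
rewrite ler_pdivrMl// mulrCA mulrC ler_pdivrMr ?ltr0n//.
rewrite -mulrA divfK//.
apply: le_trans SK.
by rewrite gerBl sqr_ge0.
Qed.

End empirical_sqrt.

(** * Gaussian integrals *)

Section gauss_integral.
Context {R : realType}.

Lemma measurable_expR_quadratic (a c z : R) :
  measurable_fun setT (fun y : R => expR (a * (y - z) - c * (y - z) ^+ 2)).
Proof.
apply: measurableT_comp => //; apply: measurable_funB.
  by apply: measurable_funM => //; exact: measurable_funB.
by apply: measurable_funM => //; apply: measurable_funX; exact: measurable_funB.
Qed.

(** Completing the square: the integrand is a multiple of the normal density
of mean z + a / (2 c) and variance 1 / (2 c). *)
Lemma integral_expR_quadratic (a c z : R) : 0 < c ->
  (\int[@lebesgue_measure R]_y (expR (a * (y - z) - c * (y - z) ^+ 2))%:E =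
   (Num.sqrt (pi / c) * expR (a ^+ 2 / (4 * c)))%:E)%E.
Proof.
move=> c0; have cn0 : c != 0 by rewrite gt_eqF.
pose s : R := Num.sqrt (2 * c)^-1; pose m := z + a / (2 * c).
have s2 : s ^+ 2 = (2 * c)^-1 by rewrite sqr_sqrtr// invr_ge0 mulr_ge0// ltW.
have sn0 : s != 0 by rewrite gt_eqF// sqrtr_gt0 invr_gt0 mulr_gt0.
have peak : (normal_peak s)^-1 = Num.sqrt (pi / c).
  rewrite /normal_peak invrK s2; congr Num.sqrt; rewrite -mulr_natr; field.
  exact: cn0.
transitivity (\int[@lebesgue_measure R]_y
    ((Num.sqrt (pi / c) * expR (a ^+ 2 / (4 * c)))%:E * (normal_pdf m s y)%:E))%E.
  apply: eq_integral => y _; rewrite -EFinM; congr EFin.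
  rewrite normal_pdfE// mulrACA -peak mulVf ?gt_eqF ?normal_peak_gt0// mul1r.
  rewrite /normal_fun s2 -expRD; congr expR; rewrite /m -mulr_natr; field.
  exact: cn0.
rewrite ge0_integralZl//; last 2 first.
- by apply/measurable_EFinP; exact: measurable_normal_pdf.
- by move=> y _; rewrite lee_fin normal_pdf_ge0.
by rewrite integral_normal_pdf mule1.
Qed.

(** Both factors decrease with the precision c, whatever the slope a is; hence
the comparison of second and first moments of the kernel holds without any
bound on the score. *)
Lemma expR_quadratic_le (a c1 c2 : R) : 0 < c1 -> c1 <= c2 ->
  Num.sqrt (pi / c2) * expR (a ^+ 2 / (4 * c2)) <=
  Num.sqrt (pi / c1) * expR (a ^+ 2 / (4 * c1)).
Proof.
move=> c10 c12; have c20 : 0 < c2 by exact: lt_le_trans c12.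
apply: ler_pM; rewrite ?sqrtr_ge0 ?expR_ge0//.
  by apply: ler_wsqrtr; rewrite ler_pM2l ?pi_gt0// lef_pV2.
rewrite ler_expR ler_wpM2l ?sqr_ge0// lef_pV2 ?posrE ?mulr_gt0//.
by rewrite ler_pM2l.
Qed.

End gauss_integral.

Section taylor.
Context {R : realType}.

(** The mean value theorem for e (g t - t g' 0) - K t^2 / 2 with a sign e,
which is nonincreasing on the positive half-line. *)
Lemma taylor1_le (g g' : R -> R) (K : R) :
  (forall t : R, is_derive t 1 g (g' t)) ->
  (forall t, 0 < t -> `|g' t - g' 0| <= K * t) ->
  `|g 1 - g 0 - g' 0| <= K / 2.
Proof.
move=> dg lipg'.
have bound (e : R) : `|e| = 1 -> e * (g 1 - g 0 - g' 0) <= K / 2.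
  move=> e1.
  pose f t := e * (g t - t * g' 0) - K / 2 * t ^+ 2.
  pose f' t := e * (g' t - g' 0) - K * t.
  have df (t : R) : is_derive t 1 f (f' t).
    rewrite /f; apply: is_derive_eq.
    by rewrite /f' /GRing.scale/=; field.
  have [|c] := @MVT R f f' 0 1 ltr01 (fun x _ => df x).
    by apply: derivable_within_continuous => x _; by have [] := df x.
  rewrite in_itv/= => /andP[c0 _] fE.
  have : f' c <= 0.
    rewrite /f' subr_le0 (le_trans (ler_norm _))// normrM e1 mul1r.
    exact: lipg'.
  rewrite -[f' c]mulr1 -[X in _ * X](subr0 1) -fE /f; lra.
by rewrite ler_norml -[_ - _ - _]mul1r bound ?normr1// lerNl -mulNr bound// normrN1.
Qed.
End taylor.

(** * Quadratic models of a density with Lipschitz score *)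

Section line_derivative.
Context {R : realType} {d : nat}.
Implicit Types (f p : 'rV[R]_d -> R) (x y v : 'rV[R]_d).

(** A difference quotient of the restriction to the line is literally a
directional difference quotient of f. *)
Lemma is_derive_line f x v (t : R) : differentiable f (x + t *: v) ->
  is_derive t 1 (fun s : R => f (x + s *: v)) ('D_v f (x + t *: v)).
Proof.
move=> df; have dv : derivable f (x + t *: v) v by exact: diff_derivable.
have E : (fun h : R => h^-1 *: (((fun s : R => f (x + s *: v)) \o shift t)
      (h *: (1 : R)) - f (x + t *: v))) =
  (fun h : R => h^-1 *: ((f \o shift (x + t *: v)) (h *: v) - f (x + t *: v))).
  apply/funext => h /=; congr (_ *: (f _ - _)).
  by rewrite [h *: 1]mulr1 scalerDl addrCA.
by apply: DeriveDef; rewrite /derivable /derive E.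
Qed.

Lemma deriveE_delta f x v : differentiable f x ->
  'D_v f x = dot (\row_i 'D_(delta_mx ord0 i) f x) v.
Proof.
move=> df; rewrite deriveE// {1}(row_sum_delta v) linear_sum.
apply: eq_bigr => i _.
by rewrite linearZ/= mxE deriveE// mulrC.
Qed.

Lemma dotNl x y : dot (- x) y = - dot x y.
Proof.
by rewrite /dot -sumrN; apply: eq_bigr => i _; rewrite mxE mulNr.
Qed.

Lemma dotBl x y v : dot (x - y) v = dot x v - dot y v.
Proof.
by rewrite /dot -sumrB; apply: eq_bigr => i _; rewrite !mxE mulrBl.
Qed.

Lemma dot_ge0 x : 0 <= dot x x.
Proof. by apply: sumr_ge0 => i _; rewrite -expr2 sqr_ge0. Qed.

Lemma dotZZ (t : R) x : dot (t *: x) (t *: x) = t ^+ 2 * dot x x.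
Proof.
by rewrite /dot mulr_sumr; apply: eq_bigr => i _; rewrite !mxE; ring.
Qed.

(** A homogeneous form of the Cauchy-Schwarz inequality, obtained
coordinatewise from 2 u v <= u^2 / l + l v^2. *)
Lemma dot_le_scaled (l : R) x v : 0 < l -> dot x x <= l ^+ 2 * dot v v ->
  `|dot x v| <= l * dot v v.
Proof.
move=> l0 xv.
have bound y : dot y y <= l ^+ 2 * dot v v -> dot y v <= l * dot v v.
  move=> yv; apply: (@le_trans _ _ ((l^-1 * dot y y + l * dot v v) / 2)).
    rewrite /dot !mulr_sumr -big_split/= mulr_suml; apply: ler_sum => i _.
    have /(mulr_ge0 (ltW l0)) := sqr_ge0 (l^-1 * y ord0 i - v ord0 i).
    have -> : l * (l^-1 * y ord0 i - v ord0 i) ^+ 2 =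
        l^-1 * (y ord0 i * y ord0 i) + l * (v ord0 i * v ord0 i)
        - 2 * (y ord0 i * v ord0 i).
      by field; rewrite gt_eqF.
    lra.
  have : l^-1 * dot y y <= l * dot v v by rewrite ler_pdivrMl// mulrA -expr2.
  lra.
rewrite ler_norml bound// andbT lerNl -dotNl bound//.
by move: xv; rewrite -scaleN1r dotZZ sqrrN expr1n mul1r.
Qed.

(** Along the segment from x to y, the derivative of ln p moves away from its
initial value at speed at most L |y - x|^2. *)
Lemma ln_density_taylor p L x y : 0 < L -> lipschitz_score L p ->
  `|ln (p y) - ln (p x) - dot (score p x) (y - x)| <= L / 2 * dot (y - x) (y - x).
Proof.
move=> L0 [p0 dp lipp].
pose v := y - x; pose g (t : R) := ln (p (x + t *: v)).
have dg (t : R) : is_derive t 1 g (dot (score p (x + t *: v)) v).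
  by have := is_derive_line (fun z => ln (p z)) x v t (dp _); rewrite deriveE_delta.
have x0 : x + 0 *: v = x by rewrite scale0r addr0.
have x1 : x + 1 *: v = y by rewrite scale1r /v addrC subrK.
have := @taylor1_le R g _ (L * dot v v) dg.
rewrite /g x0 x1 [L / 2 * _]mulrAC; apply => t t0.
rewrite -dotBl mulrAC; apply: dot_le_scaled; first exact: mulr_gt0.
have := lipp (x + t *: v) x; rewrite [x + _]addrC addrK => lip.
have : norm2 (score p (t *: v + x) - score p x) ^+ 2 <= (L * norm2 (t *: v)) ^+ 2.
  by rewrite lerXn2r ?nnegrE ?mulr_ge0 ?sqrtr_ge0 ?(ltW L0).
by rewrite exprMn /norm2 !sqr_sqrtr ?dot_ge0// dotZZ exprMn mulrA.
Qed.
End line_derivative.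

(** * The second moment of the Gaussian kernel *)

Section second_moment.
Context {R : realType} {d : nat}.
Variables (rho : probability 'rV[R]_d R) (p : 'rV[R]_d -> R) (L h : R).
Hypotheses (rhop : is_density rho p) (lipp : lipschitz_score L p).
Hypotheses (L0 : 0 < L) (h0 : 0 < h) (Lh : h <= 1 / (4 * L)).
Local Notation s := (Num.sqrt h).
Local Notation peak := (normal_peak s).
Local Notation phi := (@gauss_density R d h).

Let s0 : s != 0. Proof. by rewrite gt_eqF// sqrtr_gt0. Qed.

Let peak0 : 0 <= peak. Proof. exact: normal_peak_ge0. Qed.

Lemma ge0_integral_is_density (f : 'rV[R]_d -> R) :
  measurable_fun setT f -> (forall x, 0 <= f x) ->
  (\int[rho]_x (f x)%:E = \int[lebesgue_rV d]_x (f x * p x)%:E)%E.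
Proof.
case: rhop => mp p0 rhoE mf f0.
rewrite (@ge0_integral_density _ _ _ rho (lebesgue_rV d) p mp p0 rhoE (EFin \o f))//.
exact/measurable_EFinP.
Qed.

Lemma gauss_densityE y z :
  phi y z = \prod_i (peak * expR (- (2 * h)^-1 * (y ord0 i - z ord0 i) ^+ 2)).
Proof.
apply: eq_bigr => i _; rewrite normal_pdfE// /normal_fun sqr_sqrtr ?(ltW h0)//.
by rewrite -(opprB (y ord0 i)) sqrrN -[h *+ 2]mulr_natl mulNr mulNr [X in - X]mulrC.
Qed.

Let tilt (c : R) z (y : 'rV[R]_d) : R :=
  \prod_i expR (score p z ord0 i * (y ord0 i - z ord0 i)
                - c * (y ord0 i - z ord0 i) ^+ 2).

(** The quadratic models of p around z: multiplying by [tilt c] applies the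
tangent of ln p at z together with a Gaussian factor of precision c. *)
Lemma density_tilt_bounds y z :
  p z * tilt (L / 2) z y <= p y <= p z * tilt (- (L / 2)) z y.
Proof.
have tiltE c : p z * tilt c z y =
    expR (ln (p z) + (dot (score p z) (y - z) - c * dot (y - z) (y - z))).
  have [p0 _ _] := lipp.
  rewrite expRD lnK ?posrE// /tilt -expR_sum; congr (_ * expR _).
  rewrite sumrB -mulr_sumr; congr (_ - _ * _).
    by apply: eq_bigr => i _; rewrite !mxE.
  by apply: eq_bigr => i _; rewrite !mxE expr2.
have pyE : p y = expR (ln (p y)) by have [p0 _ _] := lipp; rewrite lnK ?posrE.
rewrite !tiltE pyE !ler_expR.
have := ln_density_taylor p L z y L0 lipp.
rewrite ler_norml => /andP[lo hi].
by apply/andP; split; lra.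
Qed.

Let gauss_tilt c z : 0 < c ->
  (\int[lebesgue_rV d]_y (tilt c z y)%:E =
   (\prod_i (Num.sqrt (pi / c) * expR (score p z ord0 i ^+ 2 / (4 * c))))%:E)%E.
Proof.
move=> c0; rewrite /tilt.
pose g (i : 'I_d) (t : R) :=
  expR (score p z ord0 i * (t - z ord0 i) - c * (t - z ord0 i) ^+ 2).
rewrite /lebesgue_rV (ge0_integral_prod_rV lebesgue_measure d g)/=; last 2 first.
- by move=> i; exact: measurable_expR_quadratic.
- by move=> i x; exact: expR_ge0.
rewrite -prodEFin; apply: eq_bigr => i _.
exact: integral_expR_quadratic.
Qed.

Lemma measurable_tilt c z : measurable_fun setT (tilt c z).
Proof.
pose g (i : 'I_d) (t : R) :=
  expR (score p z ord0 i * (t - z ord0 i) - c * (t - z ord0 i) ^+ 2).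
by apply: (measurable_prod_coord d g) => i; exact: measurable_expR_quadratic.
Qed.

Lemma tilt_ge0 c z y : 0 <= tilt c z y.
Proof. by apply: prodr_ge0 => i _; exact: expR_ge0. Qed.

(** Each factor phi raises the precision by 1 / (2 h). *)
Lemma gauss_density_tilt c z y :
  phi y z * tilt c z y = peak ^+ d * tilt (c + (2 * h)^-1) z y.
Proof.
rewrite gauss_densityE /tilt -[d in _ ^+ d]card_ord -prodr_const -!big_split/=.
by apply: eq_bigr => i _; rewrite -mulrA -expRD; congr (_ * expR _); ring.
Qed.

(** The upper model of p, times the square of the kernel, has the precision
c2 = 1 / h - L / 2; the lower model, times the kernel itself, has the precision
c1 = 1 / (2 h) + L / 2. As L <= 1 / (2 h), the former is the larger one. *)
Lemma gauss_density_second_moment_le z :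
  (\int[rho]_y (phi y z ^+ 2)%:E <= (peak ^+ d * smoothed h rho z)%:E)%E.
Proof.
have [mp p0 _] := rhop.
pose c1 : R := (2 * h)^-1 + L / 2; pose c2 : R := h^-1 - L / 2.
have Lh2 : L <= (2 * h)^-1 / 2.
  move: Lh; rewrite ler_pdivlMr ?mulr_gt0// => Lh'.
  have -> : (2 * h)^-1 / 2 = 1 / (4 * h) by field; rewrite gt_eqF.
  by rewrite ler_pdivlMr ?mulr_gt0// (le_trans _ Lh')//; lra.
have hV : h^-1 = 2 * (2 * h)^-1 by rewrite invfM mulrA divff ?mul1r.
have hV0 : 0 < (2 * h)^-1 by rewrite invr_gt0 mulr_gt0.
have c10 : 0 < c1 by rewrite addr_gt0// divr_gt0.
have c12 : c1 <= c2 by rewrite /c1 /c2 hV; lra.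
have c20 : 0 < c2 by exact: lt_le_trans c12.
have mphi : measurable_fun setT (phi ^~ z) by exact: measurable_gauss_densityr.
have ph0 : 0 <= peak ^+ d by exact: exprn_ge0.
rewrite ge0_integral_is_density; last 2 first.
- exact: measurable_funX.
- by move=> y; exact: sqr_ge0.
rewrite EFinM smoothedE// ge0_integral_is_density//; last first.
  by move=> y; exact: gauss_density_ge0.
apply: (@le_trans _ _ ((p z * peak ^+ d * peak ^+ d)%:E *
    \int[lebesgue_rV d]_y (tilt c2 z y)%:E)%E).
  rewrite -ge0_integralZl//; last 3 first.
  - by apply/measurable_EFinP; exact: measurable_tilt.
  - by move=> y _; rewrite lee_fin tilt_ge0.
  - by rewrite lee_fin !mulr_ge0.
  apply: ge0_le_integral => //.
  - by move=> y _; rewrite lee_fin mulr_ge0// sqr_ge0.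
  - by apply/measurable_EFinP; apply: measurable_funM => //; exact: measurable_funX.
  - by apply: emeasurable_funM => //; apply/measurable_EFinP; exact: measurable_tilt.
  move=> y _; rewrite -EFinM lee_fin.
  have /andP[_ py] := density_tilt_bounds y z.
  apply: (le_trans (ler_wpM2l (sqr_ge0 _) py)).
  have E : phi y z ^+ 2 * tilt (- (L / 2)) z y = peak ^+ d * peak ^+ d * tilt c2 z y.
    rewrite expr2 -mulrA gauss_density_tilt mulrCA gauss_density_tilt mulrA.
    by rewrite (_ : - (L / 2) + _ + _ = c2)// /c2 hV; ring.
  by rewrite mulrCA E !mulrA.
apply: (@le_trans _ _ ((peak ^+ d)%:E * ((p z * peak ^+ d)%:E *
    \int[lebesgue_rV d]_y (tilt c1 z y)%:E))%E).
  rewrite muleA -EFinM [in leRHS]mulrC lee_wpmul2l ?lee_fin ?mulr_ge0//.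
  rewrite !gauss_tilt// lee_fin; apply: ler_prod => i _.
  by rewrite mulr_ge0 ?sqrtr_ge0 ?expR_ge0//= expR_quadratic_le.
rewrite lee_wpmul2l ?lee_fin//.
rewrite -ge0_integralZl//; last 3 first.
- by apply/measurable_EFinP; exact: measurable_tilt.
- by move=> y _; rewrite lee_fin tilt_ge0.
- by rewrite lee_fin !mulr_ge0.
apply: ge0_le_integral => //.
- by move=> y _; rewrite -EFinM lee_fin !mulr_ge0// tilt_ge0.
- by apply: emeasurable_funM => //; apply/measurable_EFinP; exact: measurable_tilt.
- by apply/measurable_EFinP; exact: measurable_funM.
move=> y _; rewrite -EFinM lee_fin.
have /andP[py _] := density_tilt_bounds y z.
apply: le_trans (ler_wpM2l (gauss_density_ge0 _ _ _ _) py).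
by rewrite mulrCA gauss_density_tilt mulrA [c1]addrC.
Qed.

End second_moment.

(** * Subgaussian tails *)

Section tails.
Context {R : realType} {d : nat}.
Variables (rho : probability 'rV[R]_d R) (alpha h : R).
Hypotheses (subg : subgaussian alpha rho) (h0 : 0 < h).
Local Notation m := (mean rho).
Local Notation conv := (convolution rho (gaussian_rV d h)).

Lemma subgaussian_exp_moment (i : 'I_d) (t : R) :
  (\int[rho]_x (expR (t * (x ord0 i - m ord0 i)))%:E
    <= (expR (alpha ^+ 2 * t ^+ 2 / 2))%:E)%E.
Proof.
have dotd x : dot (t *: delta_mx ord0 i) x = t * x ord0 i.
  rewrite /dot (bigD1 i)//= big1 ?addr0 => [|j ji]; first by rewrite !mxE !eqxx mulr1.
  by rewrite !mxE (negbTE ji) mulr0 mul0r.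
have := subg (t *: delta_mx ord0 i).
rewrite /norm2 sqr_sqrtr ?dot_ge0// dotZZ.
have -> : dot (delta_mx ord0 i) (delta_mx ord0 i) = 1 :> R.
  rewrite /dot (bigD1 i)//= big1 ?addr0 => [|j ji]; first by rewrite !mxE !eqxx mulr1.
  by rewrite !mxE (negbTE ji) mulr0.
rewrite mulr1 unlock; apply: le_trans.
rewrite le_eqVlt; apply/orP; left; apply/eqP; apply: eq_integral => x _.
by rewrite dotd !mxE.
Qed.

Lemma gaussian_exp_moment (i : 'I_d) (t : R) :
  (\int[gaussian_rV d h]_x (expR (t * x ord0 i))%:E = (expR (h * t ^+ 2 / 2))%:E)%E.
Proof.
have s0 : Num.sqrt h != 0 by rewrite gt_eqF// sqrtr_gt0.
have mexp : measurable_fun setT (fun y : R => expR (t * y)).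
  by apply: measurableT_comp => //; exact: measurable_funM.
pose g (j : 'I_d) (y : R) := if j == i then expR (t * y) else 1.
transitivity (\int[gaussian_rV d h]_x (\prod_j g j (x ord0 j))%:E)%E.
  apply: eq_integral => x _; rewrite (bigD1 i)//= /g eqxx big1 ?mulr1// => j ji.
  by rewrite (negbTE ji).
rewrite [LHS](ge0_integral_prod_rV (normal_prob 0 (Num.sqrt h)) d g); last 2 first.
- by move=> j; rewrite /g; case: (j == i).
- by move=> j x; rewrite /g; case: ifP => // _; exact: expR_ge0.
rewrite (bigD1 i)//= big1 => [|j ji]; last first.
  rewrite /g (negbTE ji) integral_cst// mul1e; exact: probability_setT.
rewrite mule1 /g eqxx.
rewrite (@ge0_integral_density _ _ _ (normal_prob 0 (Num.sqrt h)) lebesgue_measure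
  (normal_pdf 0 (Num.sqrt h)) (measurable_normal_pdf _ _) (normal_pdf_ge0 _ _)
  (fun A _ => erefl) (fun y => (expR (t * y))%:E))//; last first.
  by apply/measurable_EFinP; exact: mexp.
transitivity (\int[@lebesgue_measure R]_y ((normal_peak (Num.sqrt h))%:E *
    (expR (t * (y - 0) - (2 * h)^-1 * (y - 0) ^+ 2))%:E))%E.
  apply: eq_integral => y _; rewrite -!EFinM; congr EFin.
  rewrite normal_pdfE// /normal_fun sqr_sqrtr ?(ltW h0)// mulrCA -expRD.
  by rewrite !subr0 -[h *+ 2]mulr_natl mulNr [X in - X]mulrC.
rewrite ge0_integralZl//; last 2 first.
- by apply/measurable_EFinP; exact: measurable_expR_quadratic.
- by rewrite lee_fin normal_peak_ge0.
rewrite integral_expR_quadratic ?invr_gt0 ?mulr_gt0// -EFinM; congr EFin.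
rewrite mulrA invrK.
have -> : normal_peak (Num.sqrt h) * Num.sqrt (pi * (2 * h)) = 1.
  rewrite /normal_peak sqr_sqrtr ?(ltW h0)// -mulr_natl.
  rewrite (_ : 2 * (h * pi) = pi * (2 * h)); last by ring.
  by rewrite mulVf// gt_eqF// sqrtr_gt0 !mulr_gt0// pi_gt0.
by rewrite mul1r; congr expR; field; rewrite gt_eqF.
Qed.

(** Independence multiplies the exponential moments of rho and of the
Gaussian. *)
Lemma convolution_exp_moment (i : 'I_d) (t : R) :
  (\int[conv]_x (expR (t * (x ord0 i - m ord0 i)))%:E
    <= (expR ((alpha ^+ 2 + h) * t ^+ 2 / 2))%:E)%E.
Proof.
have mexp (c : R) : measurable_fun setT
    (fun x : 'rV[R]_d => (expR (t * (x ord0 i - c)))%:E).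
  apply/measurable_EFinP; apply: measurableT_comp => //; apply: measurable_funM => //.
  by apply: measurable_funB => //; exact: measurable_coord.
have madd := @measurable_add_rV R d.
rewrite [leLHS](ge0_integral_pushforward madd)//=.
rewrite preimage_setT.
have mexp0 : measurable_fun setT (fun x : 'rV[R]_d => (expR (t * x ord0 i))%:E).
  by have := mexp 0; under eq_fun do rewrite subr0.
rewrite (fubini_tonelli1 (fun p : 'rV[R]_d * 'rV[R]_d =>
  (expR (t * ((p.1 + p.2) ord0 i - m ord0 i)))%:E))//; last first.
  exact: (measurableT_comp (mexp _) madd).
apply: (@le_trans _ _ (\int[rho]_x ((expR (t * (x ord0 i - m ord0 i)))%:E *
    \int[gaussian_rV d h]_y (expR (t * y ord0 i))%:E))%E).
  rewrite le_eqVlt; apply/orP; left; apply/eqP; apply: eq_integral => x _.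
  rewrite /fubini_F -ge0_integralZl//.
  apply: eq_integral => y _; rewrite -EFinM -expRD mxE; congr ((expR _)%:E); ring.
rewrite gaussian_exp_moment ge0_integralZr//.
apply: (@le_trans _ _ ((expR (alpha ^+ 2 * t ^+ 2 / 2))%:E *
    (expR (h * t ^+ 2 / 2))%:E)%E).
  by apply: lee_wpmul2r; [rewrite lee_fin expR_ge0|exact: subgaussian_exp_moment].
by rewrite -EFinM -expRD lee_fin ler_expR; lra.
Qed.

(** Outside of the box some coordinate deviates by more than r in one of the
two directions, and then one of the 2 d terms exp(- t r +- t (x_i - m_i))
is at least 1. This is Markov's inequality and the union bound in one step. *)
Lemma convolution_box_tail (r : R) : 0 < alpha -> h <= alpha ^+ 2 -> 0 <= r ->
  (conv (~` box d m r) <= (2 * d%:R * expR (- (r ^+ 2 / (4 * alpha ^+ 2))))%:E)%E.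
Proof.
move=> alpha0 halpha r0.
have a20 : 0 < alpha ^+ 2 by exact: exprn_gt0.
(* The minimizer of - t r + alpha^2 t^2, where alpha^2 t^2 comes from the
variance proxy alpha^2 + h <= 2 alpha^2 of the convolution. *)
pose t := r / (2 * alpha ^+ 2).
have t0 : 0 <= t by rewrite divr_ge0// mulr_ge0// ltW.
pose b (x : 'rV[R]_d) (i : 'I_d) (e : R) :=
  expR (- (t * r)) * expR (e * t * (x ord0 i - m ord0 i)).
have b0 x i e : 0 <= b x i e by rewrite mulr_ge0 ?expR_ge0.
have mexp c i : measurable_fun setT
    (fun x : 'rV[R]_d => expR (c * (x ord0 i - m ord0 i))).
  apply: measurableT_comp => //; apply: measurable_funM => //.
  by apply: measurable_funB => //; exact: measurable_coord.
have mb i e : measurable_fun setT (fun x => b x i e) by exact: measurable_funM.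
have mB : measurable (~` box d m r) by apply: measurableC; exact: measurable_box.
rewrite -[X in conv X]setIT -integral_indic//.
apply: (@le_trans _ _ (\int[conv]_x (\sum_(i < d) (b x i 1 + b x i (- 1))%:E))%E).
  apply: ge0_le_integral => //.
  - by apply/measurable_EFinP; exact: measurable_indic.
  - apply: emeasurable_sum => i; apply/measurable_EFinP.
    exact: measurable_funD.
  move=> x _; rewrite sumEFin lee_fin indicE.
  case: (asboolP (box d m r x)) => [xr|xr].
    by rewrite memNset//; apply: sumr_ge0 => i _; exact: addr_ge0.
  rewrite mem_set//; move/existsNP : (xr) => [i /negP]; rewrite -ltNge => xi.
  rewrite (bigD1 i)//= -[leLHS]addr0 lerD ?sumr_ge0// => [|j _]; last exact: addr_ge0.
  have e1 (u : R) : r < u -> 1 <= expR (- (t * r)) * expR (t * u).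
    move=> ru; rewrite -expRD -[leLHS]expR0 ler_expR addrC subr_ge0.
    by apply: ler_wpM2l => //; exact: ltW.
  have [xm|xm] := leP 0 (x ord0 i - m ord0 i).
    rewrite -[leLHS]addr0 lerD// /b mul1r e1//.
    by move: xi; rewrite ger0_norm.
  rewrite -[leLHS]add0r lerD// /b mulN1r mulNr -mulrN e1//.
  by move: xi; rewrite ltr0_norm.
rewrite ge0_integral_sum//; last 2 first.
- by move=> i; apply/measurable_EFinP; exact: measurable_funD.
- by move=> i x _; rewrite lee_fin addr_ge0.
apply: (@le_trans _ _ (\sum_(i < d) (2 * expR (- (r ^+ 2 / (4 * alpha ^+ 2))))%:E)%E).
  apply: lee_sum => i _.
  have bE e : `|e| = 1 -> (\int[conv]_x (b x i e)%:E <=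
      (expR (- (r ^+ 2 / (4 * alpha ^+ 2))))%:E)%E.
    move=> en; under eq_integral do rewrite EFinM.
    rewrite ge0_integralZl//; last by apply/measurable_EFinP; exact: mexp.
    apply: (le_trans (lee_wpmul2l _ (convolution_exp_moment i (e * t)))).
      by rewrite lee_fin expR_ge0.
    have e2 : e ^+ 2 = 1 by rewrite -real_normK ?num_real// en expr1n.
    rewrite -EFinM -expRD lee_fin ler_expR exprMn e2 mul1r.
    have : (alpha ^+ 2 + h) * t ^+ 2 / 2 <= alpha ^+ 2 * t ^+ 2.
      have := ler_wpM2r (sqr_ge0 t) halpha; lra.
    have -> : alpha ^+ 2 * t ^+ 2 = t * r / 2.
      by rewrite /t; field; rewrite gt_eqF.
    have -> : r ^+ 2 / (4 * alpha ^+ 2) = t * r / 2.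
      by rewrite /t; field; rewrite gt_eqF.
    lra.
  under eq_integral do rewrite EFinD.
  rewrite ge0_integralD//; last 4 first.
  - by move=> x _; rewrite lee_fin.
  - by apply/measurable_EFinP; exact: mb.
  - by move=> x _; rewrite lee_fin.
  - by apply/measurable_EFinP; exact: mb.
  rewrite mulr_natl mulr2n EFinD; apply: leeD; apply: bE; first exact: normr1.
  exact: normrN1.
rewrite sumEFin sumr_const card_ord lee_fin -[X in X <= _]mulr_natl.
by rewrite mulrA [d%:R * 2]mulrC.
Qed.

End tails.

(** * The Hellinger bound *)

Section main_bound.
Context {R : realType} {d n : nat}.
Variables (h alpha L : R) (rho : probability 'rV[R]_d R).
Context {disp : measure_display} {Omega : measurableType disp}.
Variables (P : probability Omega R) (X : 'I_n -> {RV P >-> 'rV[R]_d}).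
Hypotheses (n0 : (0 < n)%N) (h0 : 0 < h) (alpha0 : 0 < alpha) (L0 : 0 < L).
Hypotheses (rhoP : class_P alpha L rho) (Xrho : iid_sample X rho).
Hypotheses (hL : h <= 1 / (4 * L)) (halpha : h <= alpha ^+ 2).
Local Notation peak := (normal_peak (Num.sqrt h)).
Local Notation phi := (@gauss_density R d h).

Lemma smoothed_empirical (x : 'I_n -> 'rV[R]_d) z :
  smoothed h (empirical x) z = n%:R^-1 * \sum_(i < n) phi (x i) z.
Proof.
rewrite /smoothed ge0_integral_empirical//.
- by rewrite sumEFin.
- by apply/measurable_EFinP; exact: measurable_gauss_densityr.
- by move=> y; rewrite lee_fin gauss_density_ge0.
Qed.

Let F (p : Omega * 'rV[R]_d) : \bar R :=
  ((Num.sqrt (n%:R^-1 * \sum_(i < n) phi (X i p.1) p.2)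
    - Num.sqrt (smoothed h rho p.2)) ^+ 2)%:E.

Let F0 p : (0 <= F p)%E. Proof. by rewrite lee_fin sqr_ge0. Qed.

Let mF : measurable_fun setT F.
Proof.
apply: measurable_sqr_sqrtB; last first.
  exact: (measurableT_comp (measurable_smoothed h h0 rho) measurable_snd).
apply: measurable_funM => //; apply: measurable_sum => i.
have mpair : measurable_fun setT (fun p : Omega * 'rV[R]_d => (X i p.1, p.2)).
  apply: measurable_fun_pair; last exact: measurable_snd.
  by apply: measurableT_comp => //; exact: measurable_fst.
exact: (measurableT_comp (measurable_gauss_density2 h h0) mpair).
Qed.

Let G z : \bar R := (\int[P]_w F (w, z))%E.

Let G0 z : (0 <= G z)%E. Proof. exact: integral_ge0. Qed.

Let mG : measurable_fun setT G.
Proof. exact: (measurable_fun_fubini_tonelli_G F). Qed.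

Let G_le_variance z : (G z <= (peak ^+ d / n%:R)%:E)%E.
Proof.
have [_ _ [p rhop lipp]] := rhoP.
have K0 : 0 <= peak ^+ d by rewrite exprn_ge0 ?normal_peak_ge0.
exact: (empirical_sqrt_le_variance P n X rho Xrho n0 (phi ^~ z) (smoothed h rho z)
  (measurable_gauss_densityr h h0 z) (gauss_density_ge0 d h ^~ z)
  (esym (smoothedE h h0 rho z)) _ K0
  (gauss_density_second_moment_le rho p L h rhop lipp L0 h0 hL z)).
Qed.

Let G_le_mean z : (G z <= (2 * smoothed h rho z)%:E)%E.
Proof.
exact: (empirical_sqrt_le_mean P n X rho Xrho n0 (phi ^~ z) (smoothed h rho z)
  (measurable_gauss_densityr h h0 z) (gauss_density_ge0 d h ^~ z)
  (esym (smoothedE h h0 rho z))).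
Qed.

(** The variance bound is integrated over the box and the mean bound over its
complement, for any half-side r. *)
Lemma expected_hellinger2_box (r : R) : 0 <= r ->
  (\int[P]_w hellinger2 (convolution (empirical (fun i => X i w)) (gaussian_rV d h))
                        (convolution rho (gaussian_rV d h))
   <= ((2 * r * peak) ^+ d / n%:R +
       4 * d%:R * expR (- (r ^+ 2 / (4 * alpha ^+ 2))))%:E)%E.
Proof.
move=> r0; have [_ subg _] := rhoP.
pose B := box d (mean rho) r.
have mB : measurable B by exact: measurable_box.
have -> : (\int[P]_w hellinger2
      (convolution (empirical (fun i => X i w)) (gaussian_rV d h))
      (convolution rho (gaussian_rV d h)) = \int[lebesgue_rV d]_z G z)%E.
  transitivity (\int[P]_w \int[lebesgue_rV d]_z F (w, z))%E; last first.
    exact: (fubini_tonelli F mF F0).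
  apply: eq_integral => w _.
  rewrite hellinger2_convolution_gaussian//; apply: eq_integral => z _.
  by rewrite smoothed_empirical.
rewrite -(setUv B) ge0_integral_setU//; last 3 first.
- exact: measurableC.
- by rewrite setUv.
- exact/disj_setPCl.
rewrite EFinD; apply: leeD.
  apply: (@le_trans _ _ (\int[lebesgue_rV d]_(z in B) (peak ^+ d / n%:R)%:E)%E).
    apply: ge0_le_integral => //.
    by apply: measurable_funTS.
  rewrite (integral_cst (lebesgue_rV d) mB).
  suff : ((peak ^+ d / n%:R)%:E * lebesgue_rV d B <=
      ((2 * r * peak) ^+ d / n%:R)%:E)%E by [].
  rewrite lebesgue_rV_box// -EFinM lee_fin.
  by rewrite mulrAC -exprMn [_ * (2 * r)]mulrC.
apply: (@le_trans _ _
  (\int[lebesgue_rV d]_(z in ~` B) (2%:E * (smoothed h rho z)%:E))%E).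
  apply: ge0_le_integral => //.
  - exact: measurableC.
  - by apply: measurable_funTS.
  - apply: measurable_funTS; apply: emeasurable_funM => //.
    by apply/measurable_EFinP; exact: measurable_smoothed.
rewrite ge0_integralZl//; last 3 first.
- exact: measurableC.
- by apply: measurable_funTS; apply/measurable_EFinP; exact: measurable_smoothed.
- by move=> z _; rewrite lee_fin smoothed_ge0.
rewrite -convolution_gaussianE//; last exact: measurableC.
apply: (le_trans (lee_wpmul2l _
  (convolution_box_tail rho alpha h subg h0 r alpha0 halpha r0))).
  by rewrite lee_fin.
by rewrite -EFinM lee_fin; lra.
Qed.

End main_bound.

(** The base on the left squares to 16 alpha^2 l / (2 pi h), where 2 pi h is
the inverse square of the peak of the Gaussian density. *)
Lemma box_volume_constant (R : realType) (d : nat) (h alpha l : R) :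
  0 < h -> 0 < alpha -> 0 <= l ->
  (2 * (2 * alpha * Num.sqrt l) * normal_peak (Num.sqrt h)) ^+ d =
  (8 / pi * alpha ^+ 2 * l / h) `^ (d%:R / 2).
Proof.
move=> h0 alpha0 l0.
set u := 2 * _ * _.
have u0 : 0 <= u by rewrite !mulr_ge0 ?sqrtr_ge0 ?normal_peak_ge0// ltW.
have -> : 8 / pi * alpha ^+ 2 * l / h = u `^ 2%:R.
  rewrite powR_mulrn// /u /normal_peak !exprMn exprVn.
  rewrite !sqr_sqrtr ?(ltW h0)//; last first.
    by rewrite mulrn_wge0// mulr_ge0 ?pi_ge0// ltW.
  rewrite -[_ *+ 2]mulr_natl; move: (@pi R) (pi_gt0 R) => w w0; field.
  by rewrite !gt_eqF.
by rewrite -powRrM mulrC divfK// powR_mulrn.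
Qed.

Theorem lemma2 (R : realType) :
  exists C : R, 0 < C /\
  forall (d n : nat) (h alpha L : R) (rho : probability 'rV[R]_d R)
    (disp : measure_display) (Omega : measurableType disp)
    (P : probability Omega R) (X : 'I_n -> {RV P >-> 'rV[R]_d}),
  (1 <= d)%N -> (1 <= n)%N -> 0 < h -> 0 < alpha -> 1 <= alpha ^+ 2 * L ->
  class_P alpha L rho ->
  iid_sample X rho ->
  h <= 1 / (4 * L) -> h <= alpha ^+ 2 ->
  (\int[P]_w hellinger2 (convolution (empirical (fun i => X i w)) (gaussian_rV d h))
                        (convolution rho (gaussian_rV d h))
   <= (1 / n%:R * ((C * alpha ^+ 2 * ln n%:R / h) `^ (d%:R / 2))
       + 4 * d%:R / n%:R)%:E)%E.
Proof.
exists (8 / pi); split; first by rewrite divr_gt0// pi_gt0.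
move=> d n h alpha L rho disp Omega P X _ n1 h0 alpha0 aL rhoP Xrho hL halpha.
have n0 : 0 < n%:R :> R by rewrite ltr0n.
have L0 : 0 < L.
  by rewrite -(pmulr_rgt0 _ (exprn_gt0 2 alpha0)); exact: lt_le_trans aL.
have ln0 : 0 <= ln n%:R :> R by rewrite ln_ge0// ler1n.
(* With this half-side, exp(- r^2 / (4 alpha^2)) is exactly 1 / n; for n = 1 the
box is reduced to a point. *)
have r0 : 0 <= 2 * alpha * Num.sqrt (ln n%:R).
  by rewrite !mulr_ge0 ?sqrtr_ge0// ltW.
have := expected_hellinger2_box h alpha L rho P X n1 h0 alpha0 L0 rhoP Xrho
  hL halpha _ r0.
rewrite box_volume_constant// div1r [n%:R^-1 * _]mulrC.
have -> : (2 * alpha * Num.sqrt (ln n%:R)) ^+ 2 / (4 * alpha ^+ 2) = ln n%:R.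
  by rewrite !exprMn sqr_sqrtr//; field; rewrite gt_eqF.
by rewrite expRN lnK.
Qed.
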